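(* Let $\mathfrak{B}$ be a $C^*$-algebra and $\mathfrak{D}$ a $C^*$-subalgebra of $\mathfrak{B}$. Suppose that $\mathfrak{A}_1,\mathfrak{A}_2$ are $*$-algebras containing $\mathfrak{B}$, each endowed with two positive conditional expectations $\Phi_j:\mathfrak{A}_j\to\mathfrak{B}$ and $\Psi_j:\mathfrak{A}_j\to\mathfrak{D}$, $j=1,2$. Let $(\mathfrak{A},\Phi,\Psi)$ be the conditionally free (c-free) product of the triples $(\mathfrak{A}_1,\Phi_1,\Psi_1)$ and $(\mathfrak{A}_2,\Phi_2,\Psi_2)$ with amalgamation over $(\mathfrak{B},\mathfrak{D})$. Then the maps $\Phi$ and $\Psi$ are positive.
   Context: A conditional expectation from an algebra onto a subalgebra is a linear bimodule map over that subalgebra which restricts to the identity on it. A map $\Phi$ from a $*$-algebra $\mathfrak{A}$ to a $C^*$-algebra is positive if $\Phi(a^*a)\ge 0$ for all $a\in\mathfrak{A}$. c-free product: let $\{\mathfrak{A}_i\}_{i\in\mathcal{I}}$ be a family of algebras all containing the subalgebra $\mathfrak{B}$, let $\mathfrak{D}$ be a subalgebra of $\mathfrak{B}$, and let $\Psi_i:\mathfrak{A}_i\to\mathfrak{D}$, $\Phi_i:\mathfrak{A}_i\to\mathfrak{B}$ be conditional expectations. The triple $(\mathfrak{A},\Phi,\Psi)$ is the c-free product with amalgamation over $(\mathfrak{B},\mathfrak{D})$ of the triples $(\mathfrak{A}_i,\Phi_i,\Psi_i)_{i\in\mathcal{I}}$ if: (1) $\mathfrak{A}$ is the free product with amalgamation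 over $\mathfrak{B}$ of the family $(\mathfrak{A}_i)_{i\in\mathcal{I}}$ (a $*$-algebra when the $\mathfrak{A}_i$ are $*$-algebras and $\mathfrak{B}$ is a $*$-subalgebra of each); (2) $\Psi:\mathfrak{A}\to\mathfrak{D}$ and $\Phi:\mathfrak{A}\to\mathfrak{B}$ are the conditional expectations extending the $\Psi_i$, respectively the $\Phi_i$, and determined by the relations $$\Psi(a_1a_2\cdots a_n)=0,\qquad \Phi(a_1a_2\cdots a_n)=\Phi(a_1)\Phi(a_2)\cdots\Phi(a_n)$$ for all $a_k\in\mathfrak{A}_{\varepsilon(k)}$, $\varepsilon(k)\in\mathcal{I}$, such that $\varepsilon(1)\ne\varepsilon(2)\ne\dots\ne\varepsilon(n)$ (consecutive indices distinct) and $\Psi_{\varepsilon(k)}(a_k)=0$ for all $k$. *)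

(* Defs.v *)
From HB Require Import structures.
From mathcomp Require Import all_boot all_order all_algebra.
From mathcomp Require Import all_classical all_reals all_analysis.
From mathcomp Require Import complex.

Set Implicit Arguments.
Unset Strict Implicit.
Unset Printing Implicit Defensive.

Import Order.TTheory GRing.Theory Num.Theory.
Import numFieldNormedType.Exports.

Local Open Scope ring_scope.
Local Open Scope classical_set_scope.

(* No algebra below is assumed to have a unit. The algebra product is the
   semigroup product [(x * y)%g], since the ring structures of the library all
   carry a unit. When the base algebra and its embeddings are unital, the free
   product defined below is again unital and is the usual unital one. *)

HB.mixin Record Lmodule_isAlgebra (K : comPzRingType) A
    of GRing.Lmodule K A & Semigroup A := {
  amulDl : forall x y z : A, ((x + y) * z)%g = (x * z)%g + (y * z)%g;
  amulDr : forall x y z : A, (z * (x + y))%g = (z * x)%g + (z * y)%g;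
  ascalerAl : forall (k : K) (x y : A), k *: (x * y)%g = ((k *: x) * y)%g;
  ascalerAr : forall (k : K) (x y : A), k *: (x * y)%g = (x * (k *: y))%g
}.

#[short(type="nuAlgType")]
HB.structure Definition NUAlgebra (K : comPzRingType) :=
  {A of Lmodule_isAlgebra K A & GRing.Lmodule K A & Semigroup A}.

HB.mixin Record Algebra_hasStar (C : numClosedFieldType) A
    of NUAlgebra C A := {
  star : A -> A;
  starK : involutive star;
  starD : {morph star : x y / x + y};
  starZ : forall (k : C) (x : A), star (k *: x) = k^* *: star x;
  starM : forall x y : A, star (x * y)%g = (star y * star x)%g
}.

#[short(type="starAlgType")]
HB.structure Definition StarAlgebra (C : numClosedFieldType) :=
  {A of Algebra_hasStar C A & NUAlgebra C A}.

HB.mixin Record StarAlgebra_isCStar (R : realType) B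
    of StarAlgebra R[i] B & CompleteNormedModule R[i] B := {
  cstar_normM : forall x y : B, `|(x * y)%g| <= `|x| * `|y|;
  cstar_normE : forall x : B, `|(star x * x)%g| = `|x| ^+ 2
}.

#[short(type="cstarAlgType")]
HB.structure Definition CStarAlgebra (R : realType) :=
  {B of StarAlgebra_isCStar R B & StarAlgebra R[i] B
      & CompleteNormedModule R[i] B}.

Definition alg_hom (K : comPzRingType) (A A' : nuAlgType K)
    (f : {linear A -> A'}) : Prop :=
  {morph f : x y / (x * y)%g}.

Definition star_hom (C : numClosedFieldType) (A A' : starAlgType C)
    (f : {linear A -> A'}) : Prop :=
  alg_hom f /\ {morph f : x / star x}.

Record cstar_subalgebra (R : realType) (B : cstarAlgType R) (D : set B) :
    Prop := CStarSubalgebra {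
  csub0 : D 0;
  csubD : forall x y, D x -> D y -> D (x + y);
  csubZ : forall (k : R[i]) x, D x -> D (k *: x);
  csubM : forall x y, D x -> D y -> D (x * y)%g;
  csub_star : forall x, D x -> D (star x);
  csub_closed : closed D
}.

(* The positive elements of the C*-algebra [D]; [D := setT] gives those of the
   ambient algebra. *)
Definition cstar_pos (R : realType) (B : cstarAlgType R) (D : set B) : set B :=
  [set x | exists2 d, D d & x = (star d * d)%g].

Definition positive_map (R : realType) (B : cstarAlgType R) (D : set B)
    (A : starAlgType R[i]) (E : A -> B) : Prop :=
  forall a : A, cstar_pos D (E (star a * a)%g).

(* [A] contains [B] through [iota], and [D] is a subalgebra of [B]. *)
Definition cond_expectation (K : comPzRingType) (B A : nuAlgType K)
    (iota : {linear B -> A}) (D : set B) (E : {linear A -> B}) : Prop :=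
  [/\ forall a, D (E a),
      forall d a, D d -> E (iota d * a)%g = (d * E a)%g,
      forall a d, D d -> E (a * iota d)%g = (E a * d)%g
    & forall d, D d -> E (iota d) = d].

(* Pushout of the embeddings [iota i : B -> A_ i] in the category of
   algebras. *)
Definition amalgamated_free_product (K : comPzRingType) (B : nuAlgType K)
    (I : Type) (A_ : I -> nuAlgType K) (iota : forall i, {linear B -> A_ i})
    (A : nuAlgType K) (eta : {linear B -> A})
    (kappa : forall i, {linear A_ i -> A}) : Prop :=
  [/\ alg_hom eta, forall i, alg_hom (kappa i),
      forall i b, kappa i (iota i b) = eta b
    & forall (T : nuAlgType K) (g : {linear B -> T})
        (f : forall i, {linear A_ i -> T}),
        alg_hom g -> (forall i, alg_hom (f i)) ->
        (forall i b, f i (iota i b) = g b) ->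
        let extends (h : {linear A -> T}) :=
          [/\ alg_hom h, forall b, h (eta b) = g b
            & forall i a, h (kappa i a) = f i a] in
        exists2 h, extends h & forall h', extends h' -> h' =1 h].

Fixpoint mulword (G : magmaType) (x : nat -> G) (n : nat) : G :=
  if n is m.+1 then (mulword x m * x n)%g else x 0%N.

(* [mulword x n] is [x 0 * x 1 * ... * x n], so the words below have [n.+1]
   letters; the values [eps k] and [a k] for [k > n] play no role. *)
Definition cfree_relations (K : comPzRingType) (B : nuAlgType K)
    (I : Type) (A_ : I -> nuAlgType K)
    (Phi_ Psi_ : forall i, {linear A_ i -> B})
    (A : nuAlgType K) (kappa : forall i, {linear A_ i -> A})
    (Phi Psi : {linear A -> B}) : Prop :=
  forall (n : nat) (eps : nat -> I) (a : forall k, A_ (eps k)),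
    (forall k, (k < n)%N -> eps k <> eps k.+1) ->
    (forall k, (k <= n)%N -> Psi_ (eps k) (a k) = 0) ->
    let w k := kappa (eps k) (a k) in
    Psi (mulword w n) = 0 /\
    Phi (mulword w n) = mulword (fun k => Phi (w k)) n.

(* [(A, Phi, Psi)] is the c-free product of the [(A_ i, Phi_ i, Psi_ i)] with
   amalgamation over [(B, D)]; the involution of [A] extends those of the
   [A_ i]. *)
Record cfree_product (C : numClosedFieldType) (B : starAlgType C) (D : set B)
    (I : Type) (A_ : I -> starAlgType C) (iota : forall i, {linear B -> A_ i})
    (Phi_ Psi_ : forall i, {linear A_ i -> B})
    (A : starAlgType C) (eta : {linear B -> A})
    (kappa : forall i, {linear A_ i -> A}) (Phi Psi : {linear A -> B}) :
    Prop := CFreeProduct {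
  cfree_free : amalgamated_free_product iota eta kappa;
  cfree_star_base : star_hom eta;
  cfree_star : forall i, star_hom (kappa i);
  cfree_Phi_cond : cond_expectation eta setT Phi;
  cfree_Psi_cond : cond_expectation eta D Psi;
  cfree_Phi_ext : forall i a, Phi (kappa i a) = Phi_ i a;
  cfree_Psi_ext : forall i a, Psi (kappa i a) = Psi_ i a;
  cfree_rel : cfree_relations Phi_ Psi_ kappa Phi Psi
}.

(* Main.v *)
Require Import Defs.
From Stdlib Require Ncring Ncring_tac.
From HB Require Import structures.
From mathcomp Require Import all_boot all_order all_algebra.
From mathcomp Require Import all_classical all_reals all_analysis.
From mathcomp Require Import complex ring lra.
Import Order.TTheory GRing.Theory Num.Theory.
Import numFieldNormedType.Exports.
Set Implicit Arguments.
Unset Strict Implicit.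
Unset Printing Implicit Defensive.
Local Open Scope complex_scope.
Local Open Scope ring_scope.
Local Open Scope classical_set_scope.

(** Both assertions are one statement: the map [Phi] takes values in a
    C*-subalgebra [E] containing [D], is a conditional expectation onto [E] and
    is multiplicative on alternating products of [Psi]-centered letters.  This
    holds for [Phi] with [E := setT], and for [Psi] with [E := D], where both
    sides of multiplicativity vanish; [cfree_positive] treats the common case.

    For [x], [y] in the free product put [C(x, y) = Phi(x^* y) - Phi(x)^* Phi(y)];
    it suffices that [C(x, x)] is positive.  By the universal property every
    element is a sum [x_0 + x_1], where [x_j] is spanned by [D] and by the
    alternating centered words that start in [A_j].  Multiplicativity makes [x_0]
    and [x_1] orthogonal for [C], and gives for [x = sum_k a_k w_k], with
    letters [a_k] of [A_j] and tails [w_k] that start in the other algebra,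
<<
      C(x, x) = sum_kl C(w_k, Psi(a_k^* a_l) w_l)
              + sum_kl Phi(w_k)^* C_j(a_k, a_l) Phi(w_l)
>>
    where [C_j] is the analogue of [C] for [Phi_j] ([cov_letters]).  The second
    sum is [C_j(z, z)] for [z = sum_k a_k Phi(w_k)], which is positive because
    [C_j(z, z) = Phi_j((z - Phi_j z)^* (z - Phi_j z))].  In the first one the
    matrix [P_kl = Psi(a_k^* a_l)] over [D] is positive as a quadratic form, and
    [C] is positive on the span of the [w_k] by induction on the length of
    words.  The conclusion then follows from a Cholesky reduction carried out
    inside [D] ([qform_psd]): one splits off a square by completing it with the
    inverse of [P_nn + e], passes to the Schur complement, and lets [e] tend
    to [0].

    What this needs about C*-algebras is that the elements [x^* x] form a closed
    convex cone, and that [p + e] is invertible for [p] in the cone and [e > 0].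
    Algebras need not be unital, so all computations take place in unitizations.
    There the cone is defined by a norm condition, [|t - h| <= t] for some real
    [t], which is visibly convex; square roots, obtained by iterating a quadratic
    polynomial, identify it with the squares of selfadjoint elements, and the
    theorem of Fukamiya and Kaplansky ([psd_star_mul]) puts every [x^* x] in it. *)

(** * Identities in noncommutative rings *)

Section NoncommutativeRing.
Context (U : nzRingType).

#[export] Instance nc_ops :
  @Ncring.Ring_ops U 0 1 +%R *%R (fun x y => x - y) -%R eq := {}.

#[export] Instance nc_ring : @Ncring.Ring _ _ _ _ _ _ _ _ nc_ops.
Proof.
constructor; try exact: RelationClasses.eq_equivalence; try by move=> ? ? -> ? ? ->.
- by move=> ? ? ->.
- exact: add0r.
- exact: addrC.
- exact: addrA.
- exact: mul1r.
- exact: mulr1.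
- exact: mulrA.
- exact: mulrDl.
- by move=> x y z; exact: mulrDr.
- by [].
- exact: subrr.
Qed.

End NoncommutativeRing.

Ltac ncring := rewrite ?expr2 ?mulr2n; Ncring_tac.non_commutative_ring.

(** * Unitization of a star-algebra *)

Section NonUnitalAlgebra.
Context (K : comPzRingType) (A : nuAlgType K).
Implicit Types x y : A.

Lemma amul0 x : (x * 0)%g = 0.
Proof. by apply: (@addrI _ (x * 0)%g); rewrite -amulDr !addr0. Qed.
Lemma a0mul x : (0 * x)%g = 0.
Proof. by apply: (@addrI _ (0 * x)%g); rewrite -amulDl !addr0. Qed.

End NonUnitalAlgebra.

(** The base field acts on itself through [C^o], so that the module structure is
    that of the product; the pair [(l, a)] stands for [l + a]. *)
Definition unitization (C : numClosedFieldType) (A : starAlgType C) : Type :=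
  (C^o * A)%type.

Section Unitization.
Context (C : numClosedFieldType) (A : starAlgType C).
Local Notation U := (unitization A).

HB.instance Definition _ := GRing.Lmodule.copy U (C^o * A)%type.

Definition unitization_one : U := (1, 0).
Definition unitization_mul (x y : U) : U :=
  (x.1 * y.1, x.1 *: y.2 + y.1 *: x.2 + (x.2 * y.2)%g).

Fact unitization_mulA : associative unitization_mul.
Proof.
move=> [a x] [b y] [c z]; congr pair => /=; first exact: mulrA.
rewrite !scalerDr !scalerA !amulDl !amulDr mulgA.
rewrite -!ascalerAl -!ascalerAr -!addrA; congr (_ + _).
rewrite [c * a]mulrC [c * b]mulrC; congr (_ + _).
rewrite addrCA; congr (_ + _).
by rewrite [RHS]addrCA; congr (_ + _); rewrite [RHS]addrCA.
Qed.

Fact unitization_mul1 : left_id unitization_one unitization_mul.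
Proof.
by move=> [a x]; congr pair; rewrite /= ?mul1r// scale1r scaler0 a0mul !addr0.
Qed.

Fact unitization_mulr1 : right_id unitization_one unitization_mul.
Proof.
by move=> [a x]; congr pair; rewrite /= ?mulr1// scale1r scaler0 amul0 add0r addr0.
Qed.

Fact unitization_mulDl : left_distributive unitization_mul +%R.
Proof.
move=> [a x] [b y] [c z]; congr pair => /=; first exact: mulrDl.
by rewrite scalerDl scalerDr amulDl [RHS]addrACA; congr (_ + _); rewrite addrACA.
Qed.

Fact unitization_mulDr : right_distributive unitization_mul +%R.
Proof.
move=> [a x] [b y] [c z]; congr pair => /=; first exact: mulrDr.
by rewrite scalerDl scalerDr amulDr [RHS]addrACA; congr (_ + _); rewrite addrACA.
Qed.

Fact unitization_oner_neq0 : unitization_one != 0.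
Proof. by apply/eqP => -[/eqP]; rewrite oner_eq0. Qed.

HB.instance Definition _ := GRing.Zmodule_isNzRing.Build U
  unitization_mulA unitization_mul1 unitization_mulr1
  unitization_mulDl unitization_mulDr unitization_oner_neq0.

Fact unitization_scalerAl (k : C) (x y : U) : k *: (x * y) = (k *: x) * y.
Proof.
congr pair => /=; first exact: mulrA.
by rewrite !scalerDr !scalerA ascalerAl [k * y.1]mulrC.
Qed.

HB.instance Definition _ :=
  GRing.Lmodule_isLalgebra.Build C U unitization_scalerAl.

Fact unitization_scalerAr (k : C) (x y : U) : k *: (x * y) = x * (k *: y).
Proof.
congr pair => /=; first exact: mulrCA.
by rewrite !scalerDr !scalerA ascalerAr [k * x.1]mulrC.
Qed.

HB.instance Definition _ :=
  GRing.Lalgebra_isAlgebra.Build C U unitization_scalerAr.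

Definition incl (a : A) : U := (0, a).

Fact incl_is_linear : linear incl.
Proof. by move=> k a b; congr pair; rewrite /= addr0; exact/esym/mulr0. Qed.

HB.instance Definition _ := GRing.isLinear.Build C A U _ incl incl_is_linear.

Lemma inclM (a b : A) : incl (a * b)%g = incl a * incl b.
Proof. by congr pair; rewrite /= ?mul0r// !scale0r !add0r. Qed.

Lemma inclP (x : U) : x.1 = 0 -> x = incl x.2.
Proof. by case: x => l a /= ->. Qed.

Lemma scalar1 (k : C) : (k%:A : U) = (k, 0).
Proof. by congr pair; rewrite /= ?scaler0// [LHS]mulr1. Qed.

Lemma unitizationE (x : U) : x = x.1%:A + incl x.2.
Proof. by case: x => l a; rewrite scalar1; congr pair; rewrite /= ?addr0 ?add0r. Qed.

Lemma star0 : star (0 : A) = 0.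
Proof. by apply: (@addrI _ (star (0 : A))); rewrite -starD !addr0. Qed.

Definition adj (x : U) : U := (x.1^*, star x.2).

Fact adj_is_additive : zmod_morphism adj.
Proof.
move=> [a x] [b y]; congr pair => /=; first by rewrite rmorphB.
rewrite starD; congr (_ + _); apply: (@addrI _ (star y)).
by rewrite -starD !subrr star0.
Qed.

HB.instance Definition _ := GRing.isZmodMorphism.Build U U adj adj_is_additive.

Lemma adjK : involutive adj.
Proof. by move=> [a x]; rewrite /adj /= conjCK starK. Qed.

Lemma adjM (x y : U) : adj (x * y) = adj y * adj x.
Proof.
congr pair; first by rewrite /= mulrC rmorphM.
by rewrite /= !starD !starZ starM; congr (_ + _); rewrite addrC.
Qed.

Lemma adjZ (k : C) (x : U) : adj (k *: x) = k^* *: adj x.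
Proof. by congr pair; rewrite /= ?rmorphM// starZ. Qed.

Lemma adj1 : adj 1 = 1.
Proof. by rewrite /adj /= rmorph1 star0. Qed.

Lemma adj_incl (a : A) : adj (incl a) = incl (star a).
Proof. by rewrite /adj /= rmorph0. Qed.

End Unitization.

Section UnitizationMap.
Context (C : numClosedFieldType) (A A' : starAlgType C) (f : {linear A -> A'}).

Definition umap (x : unitization A) : unitization A' := (x.1, f x.2).

Fact umap_is_linear : linear umap.
Proof. by move=> k x y; congr pair; rewrite /= ?linearP. Qed.

HB.instance Definition _ := GRing.isLinear.Build C (unitization A)
  (unitization A') _ umap umap_is_linear.

Lemma umap1 : umap 1 = 1.
Proof. by rewrite /umap /= raddf0. Qed.

Lemma umap_incl (a : A) : umap (incl a) = incl (f a).
Proof. by []. Qed.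

Lemma umapM : alg_hom f -> {morph umap : x y / x * y}.
Proof. by move=> fM x y; congr pair; rewrite /= !linearD !linearZ fM. Qed.

Lemma umap_adj : {morph f : x / star x} -> {morph umap : x / adj x}.
Proof. by move=> fs x; congr pair; rewrite /= fs. Qed.

End UnitizationMap.

(** * The operator norm on the unitization of a C*-algebra *)

Section RealNorm.
Context (R : realType).

(** The norm has values in the complex field; its real part moves estimates to
    the ordered field [R], where linear arithmetic is available. *)
Definition nrm (V : normedZmodType R[i]) (x : V) : R := complex.Re `|x|.

Lemma nrmE (V : normedZmodType R[i]) (x : V) : `|x| = (nrm x)%:C.
Proof. by rewrite RRe_real// normr_real. Qed.

Lemma nrm_ge0 (V : normedZmodType R[i]) (x : V) : 0 <= nrm x.
Proof. by rewrite -ler0c -nrmE. Qed.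

Lemma nrmD (V : normedZmodType R[i]) (x y : V) : nrm (x + y) <= nrm x + nrm y.
Proof. by rewrite -lecR rmorphD /= -!nrmE ler_normD. Qed.

Lemma nrmN (V : normedZmodType R[i]) (x : V) : nrm (- x) = nrm x.
Proof. by rewrite /nrm normrN. Qed.

Lemma nrm0 (V : normedZmodType R[i]) : nrm (0 : V) = 0.
Proof. by rewrite /nrm normr0. Qed.

Lemma nrm0_eq0 (V : normedZmodType R[i]) (x : V) : nrm x = 0 -> x = 0.
Proof. by move=> x0; apply/eqP; rewrite -normr_eq0 nrmE x0. Qed.

Lemma nrmZ (V : normedModType R[i]) (k : R[i]) (x : V) :
  nrm (k *: x) = nrm k * nrm x.
Proof. by apply: complexI; rewrite rmorphM /= -!nrmE normrZ. Qed.

Lemma nrm_conj (k : R[i]) : nrm (k^*)%R = nrm k.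
Proof. by rewrite /nrm norm_conjC. Qed.

Lemma nrmc_mul (k l : R[i]) : nrm (k * l) = nrm k * nrm l.
Proof. by apply: complexI; rewrite rmorphM /= -!nrmE normrM. Qed.

Lemma nrm_real (c : R) : nrm (c%:C) = `|c|.
Proof. by rewrite /nrm normc_def /= expr0n /= addr0 sqrtr_sqr. Qed.

End RealNorm.

Section CStarBounds.
Context (R : realType) (B : cstarAlgType R).
Local Notation U := (unitization B).
Implicit Types (x y : B) (u v : U) (c d : R).

Lemma nrmM x y : nrm (x * y)%g <= nrm x * nrm y.
Proof. by rewrite -lecR rmorphM /= -!nrmE cstar_normM. Qed.

Lemma nrm_starM x : nrm (star x * x)%g = nrm x ^+ 2.
Proof. by apply: complexI; rewrite rmorphXn /= -!nrmE cstar_normE. Qed.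

Lemma nrm_star_le x : nrm x <= nrm (star x).
Proof.
have [->|x0] := eqVneq (nrm x) 0; first exact: nrm_ge0.
have xgt0 : 0 < nrm x by rewrite lt_def x0 nrm_ge0.
by rewrite -(ler_pM2r xgt0) -expr2 -nrm_starM nrmM.
Qed.

Lemma nrm_star x : nrm (star x) = nrm x.
Proof.
apply/eqP; rewrite eq_le nrm_star_le andbT.
by rewrite -[X in _ <= nrm X]starK nrm_star_le.
Qed.

(** The unitization acts on [B] by left multiplication, [B] being an ideal of it. *)
Definition act u x : B := u.1 *: x + (u.2 * x)%g.

(** [u] has norm at most [c] as an operator on [C] plus [B].  The bound on the
    scalar part makes the associated norm separating even if [B] has a unit, in
    which case some nonzero [u] acts as zero on [B].  A relation replaces the
    norm itself, since only upper bounds are ever used. *)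
Definition bnd u c : Prop :=
  nrm u.1 <= c /\ forall x, nrm (act u x) <= c * nrm x.

Lemma actM u v x : act (u * v) x = act u (act v x).
Proof.
rewrite /act /= !amulDl !amulDr !scalerDr scalerA -!addrA mulgA; congr (_ + _).
by rewrite -!ascalerAl -ascalerAr.
Qed.

Lemma actD u v x : act (u + v) x = act u x + act v x.
Proof. by rewrite /act /= amulDl scalerDl addrACA. Qed.

Lemma actZ (k : R[i]) u x : act (k *: u) x = k *: act u x.
Proof. by rewrite /act /= scalerDr ascalerAl scalerA. Qed.

Lemma act_adj u x y : (star (act u x) * y)%g = (star x * act (adj u) y)%g.
Proof.
rewrite /act /= starD starZ starM amulDl amulDr mulgA.
by rewrite -ascalerAl -ascalerAr.
Qed.

Lemma bnd_ge0 u c : bnd u c -> 0 <= c.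
Proof. by move=> [h _]; apply: le_trans h; exact: nrm_ge0. Qed.

Lemma bnd_mono u c d : c <= d -> bnd u c -> bnd u d.
Proof.
move=> cd [h1 h2]; split; first exact: le_trans cd.
by move=> x; apply: le_trans (h2 x) _; rewrite ler_wpM2r// nrm_ge0.
Qed.

Lemma bndD u v c d : bnd u c -> bnd v d -> bnd (u + v) (c + d).
Proof.
move=> [h1 h2] [k1 k2]; split; first by apply: le_trans (nrmD _ _) _; exact: lerD.
by move=> x; rewrite actD mulrDl; apply: le_trans (nrmD _ _) _; exact: lerD.
Qed.

Lemma bndM u v c d : bnd u c -> bnd v d -> bnd (u * v) (c * d).
Proof.
move=> bu [k1 k2]; have c0 := bnd_ge0 bu; case: bu => h1 h2; split.
  by rewrite nrmc_mul ler_pM// nrm_ge0.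
move=> x; rewrite actM; apply: le_trans (h2 _) _.
by rewrite -mulrA ler_wpM2l.
Qed.

Lemma bndZ (k : R[i]) u c : bnd u c -> bnd (k *: u) (nrm k * c).
Proof.
move=> [h1 h2]; split; first by rewrite nrmc_mul ler_wpM2l// nrm_ge0.
by move=> x; rewrite actZ nrmZ -mulrA ler_wpM2l// nrm_ge0.
Qed.

Lemma bndN u c : bnd u c -> bnd (- u) c.
Proof. by move=> /(bndZ (-1)); rewrite scaleN1r nrmN /nrm normr1 mul1r. Qed.

Lemma bndB u v c d : bnd u c -> bnd v d -> bnd (u - v) (c + d).
Proof. by move=> bu bv; apply: bndD => //; exact: bndN. Qed.

(** [|u x|^2 = |x^* (u^* u) x|] for [x] in [B]: the operator norm inherits the
    C*-identity. *)
Lemma bnd_cstar u c : 0 <= c -> bnd (adj u * u) (c ^+ 2) -> bnd u c.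
Proof.
move=> c0 [h1 h2]; split.
  rewrite -(@ler_pXn2r _ 2)// ?nnegrE ?nrm_ge0//.
  by apply: le_trans h1; rewrite /= nrmc_mul nrm_conj expr2.
move=> x; rewrite -(@ler_pXn2r _ 2)// ?nnegrE ?mulr_ge0 ?nrm_ge0//.
rewrite -nrm_starM act_adj -actM.
apply: le_trans (nrmM _ _) _; rewrite nrm_star exprMn mulrC [nrm x ^+ 2]expr2 mulrA.
by rewrite ler_wpM2r// nrm_ge0.
Qed.

Lemma bnd_adj u c : bnd u c -> bnd (adj u) c.
Proof.
move=> bu; have c0 := bnd_ge0 bu; case: bu => h1 h2; split; first by rewrite nrm_conj.
move=> x; set z := act _ _.
have [->|z0] := eqVneq (nrm z) 0; first by rewrite mulr_ge0// nrm_ge0.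
have zgt0 : 0 < nrm z by rewrite lt_def z0 nrm_ge0.
rewrite -(ler_pM2r zgt0) -expr2 -nrm_starM {1}/z act_adj adjK.
apply: le_trans (nrmM _ _) _; rewrite nrm_star [c * _]mulrC -mulrA.
by rewrite ler_wpM2l// nrm_ge0.
Qed.

Lemma bnd0 c : 0 <= c -> bnd 0 c.
Proof.
move=> c0; split; first by rewrite nrm0.
by move=> x; rewrite /act /= scale0r a0mul addr0 nrm0 mulr_ge0// nrm_ge0.
Qed.

Lemma bnd1 : bnd 1 1.
Proof.
split; first by rewrite /nrm normr1.
by move=> x; rewrite /act /= scale1r a0mul addr0 mul1r.
Qed.

(** Evaluating at [x^*] shows that [B] sits isometrically in its unitization. *)
Lemma bnd_incl x c : bnd (incl x) c <-> nrm x <= c.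
Proof.
split=> [bx|xc].
  have c0 := bnd_ge0 bx; case: bx => _ /(_ (star x)).
  rewrite /act /= scale0r add0r -{1}[x]starK nrm_starM nrm_star.
  have [->//|x0] := eqVneq (nrm x) 0.
  by rewrite expr2 ler_pM2r// lt_def x0 nrm_ge0.
split; first by rewrite nrm0; apply: le_trans xc; exact: nrm_ge0.
move=> y; rewrite /act /= scale0r add0r; apply: le_trans (nrmM _ _) _.
by rewrite ler_wpM2r// nrm_ge0.
Qed.

Definition real_scalar c : U := (c%:C)%:A.

Lemma bnd_rs c : bnd (real_scalar c) `|c|.
Proof. by have := bndZ c%:C bnd1; rewrite nrm_real mulr1. Qed.

Lemma bnd_exists u : exists c, bnd u c.
Proof.
exists (nrm u.1 * 1 + nrm u.2); rewrite [u in bnd u]unitizationE.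
by apply: bndD; [apply: bndZ; exact: bnd1|apply/bnd_incl].
Qed.

Lemma bnd_lim u c : (forall e, 0 < e -> bnd u (c + e)) -> bnd u c.
Proof.
move=> h; split; first by apply/ler_addgt0Pr => e /h [].
move=> x; apply/ler_addgt0Pr => e e0.
have x1 : 0 < nrm x + 1 by rewrite ltr_wpDl// nrm_ge0.
have [_ /(_ x)] := h _ (divr_gt0 e0 x1); move/le_trans; apply.
rewrite mulrDl lerD2l mulrAC ler_pdivrMr// ler_wpM2l ?(ltW e0)//.
by rewrite lerDl ler01.
Qed.

(** The two components are controlled by the norm, so that completeness of [B]
    passes to the unitization. *)
Lemma bnd_snd u c : bnd u c -> nrm u.2 <= c + c.
Proof.
move=> bu; apply/bnd_incl.
have -> : incl u.2 = u - u.1%:A by rewrite {2}[u]unitizationE addrAC subrr add0r.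
apply: bndB => //; apply: bnd_mono (bndZ u.1 bnd1).
by rewrite mulr1; case: bu.
Qed.

Lemma bnd_eq0 u : (forall e, 0 < e -> bnd u e) -> u = 0.
Proof.
move=> h; have b0 : bnd u 0 by apply: bnd_lim => e /h; rewrite add0r.
have u1 : u.1 = 0.
  by apply: nrm0_eq0; apply/eqP; rewrite eq_le nrm_ge0 andbT; case: b0.
have u2 : u.2 = 0.
  apply: nrm0_eq0; apply/eqP; rewrite eq_le nrm_ge0 andbT.
  by have := bnd_snd b0; rewrite addr0.
by rewrite [u]inclP// u2; exact: raddf0.
Qed.

End CStarBounds.

(** * Limits in the unitization *)

Lemma cauchy_seq_cvg (K : numFieldType) (V : completeNormedModType K)
    (u : nat -> V) :
  (forall e : K, 0 < e -> exists N, forall n, (N <= n)%N -> `|u N - u n| < e) ->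
  exists l, forall e : K, 0 < e -> exists N, forall n, (N <= n)%N -> `|l - u n| < e.
Proof.
move=> h.
have /cauchy_cvgP ucvg : cauchy (u @ \oo).
  apply: cauchy_exP => e e0; have [N hN] := h e e0.
  exists (u N); exists N => // n /= Nn.
  by rewrite -ball_normE; exact: hN.
exists (lim (u @ \oo)) => e e0.
have /cvgrPdist_lt/(_ e e0)[N _ hN] := ucvg.
by exists N => n Nn; exact: hN.
Qed.

Section Limits.
Context (R : realType) (B : cstarAlgType R).
Local Notation U := (unitization B).
Implicit Types (u v : U) (y : nat -> U).

Definition ulim y u := forall e : R, 0 < e ->
  exists N, forall n, (N <= n)%N -> bnd (u - y n) e.

Lemma ulim_cst u : ulim (fun=> u) u.
Proof. by move=> e e0; exists 0 => n _; rewrite subrr; apply/bnd0/ltW. Qed.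

Lemma ulim_shift y u : ulim y u -> ulim (fun n => y n.+1) u.
Proof.
by move=> h e /h[N hN]; exists N => n Nn; apply: hN; exact: leq_trans (leqnSn n).
Qed.

Lemma ulim_unique y u v : ulim y u -> ulim y v -> u = v.
Proof.
move=> hu hv; apply/eqP; rewrite -subr_eq0; apply/eqP; apply: bnd_eq0 => e e0.
have e20 : 0 < e / 2 by rewrite divr_gt0.
have [N hN] := hu _ e20; have [M hM] := hv _ e20.
have -> : u - v = (u - y (maxn N M)) - (v - y (maxn N M)) by ncring.
by rewrite (splitr e); apply: bndB; [apply: hN|apply: hM]; rewrite ?leq_maxl ?leq_maxr.
Qed.

Lemma ulimD y y' u u' : ulim y u -> ulim y' u' -> ulim (fun n => y n + y' n) (u + u').
Proof.
move=> hu hv e e0.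
have e20 : 0 < e / 2 by rewrite divr_gt0.
have [N hN] := hu _ e20; have [M hM] := hv _ e20.
exists (maxn N M) => n; rewrite geq_max => /andP[Nn Mn].
have -> : u + u' - (y n + y' n) = (u - y n) + (u' - y' n) by ncring.
by rewrite (splitr e); apply: bndD; [apply: hN|apply: hM].
Qed.

Lemma ulimM y y' u u' : ulim y u -> ulim y' u' -> ulim (fun n => y n * y' n) (u * u').
Proof.
move=> hu hv e e0.
have [c bc] := bnd_exists u; have [d bd] := bnd_exists u'.
have c0 := bnd_ge0 bc; have d0 := bnd_ge0 bd.
pose r := e / (c + d + 1 + e).
have D0 : 0 < c + d + 1 + e by lra.
have r0 : 0 < r by rewrite divr_gt0.
have r1 : r <= 1 by rewrite ler_pdivrMr// mul1r; lra.
have rE : r * (c + d + 1) <= e.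
  by rewrite mulrAC ler_pdivrMr// ler_wpM2l ?ltW//; lra.
have [N hN] := hu _ r0; have [M hM] := hv _ r0.
exists (maxn N M) => n; rewrite geq_max => /andP[Nn Mn].
have -> : u * u' - (y n * y' n) =
  u * (u' - y' n) + ((u - y n) * u' - (u - y n) * (u' - y' n)) by ncring.
have bN := hN _ Nn; have bM := hM _ Mn.
apply: bnd_mono (bndD (bndM bc bM) (bndB (bndM bN bd) (bndM bN bM))).
by nra.
Qed.

Lemma ulim_adj y u : ulim y u -> ulim (fun n => adj (y n)) (adj u).
Proof.
by move=> h e /h[N hN]; exists N => n /hN /bnd_adj; rewrite raddfB.
Qed.

(** Completeness, in the form of domination by a bounded real sequence.
    Selfadjointness makes the scalar parts real, which reduces their convergence
    to that of real sequences. *)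
Lemma ulim_exists y (s : nat -> R) (S : R) :
    (forall n, adj (y n) = y n) ->
    (forall n, bnd (y n.+1 - y n) (s n.+1 - s n)) -> (forall n, s n <= S) ->
  exists u, ulim y u.
Proof.
move=> yadj yb sS.
have s_nd : nondecreasing_seq s.
  by apply/nondecreasing_seqP => n; rewrite -subr_ge0; exact: bnd_ge0 (yb n).
have scvg : s @ \oo --> limn s.
  by apply: nondecreasing_is_cvgn => //; exists S => _ [n _ <-].
have s_le n : s n <= limn s by apply: nondecreasing_cvgn_le => //; apply/cvg_ex; exists (limn s).
have yb' n k : bnd (y (n + k)%N - y n) (s (n + k)%N - s n).
  elim: k => [|k ih]; first by rewrite addn0 !subrr; exact: bnd0.
  rewrite addnS; have := bndD (yb (n + k)%N) ih.
  by rewrite !subrKA.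
have cau e : 0 < e -> exists N, forall n, (N <= n)%N -> bnd (y N - y n) e.
  move=> e0; have /cvgrPdist_lt/(_ e e0)[N _ hN] := scvg.
  exists N => n Nn; rewrite -(subnKC Nn) -opprB; apply/bndN.
  apply: bnd_mono (yb' _ _); rewrite subnKC//.
  have := hN N (leqnn N); rewrite ger0_norm ?subr_ge0// => h.
  by have := s_le n; lra.
have yreal n : (y n).1 = (complex.Re (y n).1)%:C.
  have /(congr1 fst) /= := yadj n => h; rewrite RRe_real//.
  by apply/CrealP.
have [l hl] : exists l : R^o, forall e : R, 0 < e ->
    exists N, forall n, (N <= n)%N -> `|l - complex.Re (y n).1| < e.
  apply: (@cauchy_seq_cvg _ R^o (fun n => complex.Re (y n).1)) => e e0.
  have e20 : 0 < e / 2 by rewrite divr_gt0.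
  have [N hN] := cau _ e20; exists N => n /hN[h _].
  apply: le_lt_trans (_ : e / 2 < e); last by lra.
  by apply: le_trans h; rewrite /= (yreal N) (yreal n) -rmorphB /= nrm_real.
have [d hd] : exists d : B, forall e : R[i], 0 < e ->
    exists N, forall n, (N <= n)%N -> `|d - (y n).2| < e.
  apply: cauchy_seq_cvg => e e0.
  have er : e = (complex.Re e)%:C by rewrite RRe_real// gtr0_real.
  have e30 : 0 < complex.Re e / 3 by rewrite divr_gt0// -ltcR -er.
  have [N hN] := cau _ e30; exists N => n /hN/bnd_snd h.
  by rewrite nrmE er ltcR; apply: le_lt_trans h _; lra.
exists (l%:C, d) => e e0.
have e20 : 0 < e / 2 by rewrite divr_gt0.
have e20C : (0 : R[i]) < (e / 2)%:C by rewrite ltcR.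
have [N hN] := hl _ e20; have [M hM] := hd _ e20C.
exists (maxn N M) => n; rewrite geq_max => /andP[Nn Mn].
rewrite [_ - _]unitizationE (splitr e); apply: bndD.
  have := bndZ ((l%:C, d) - y n).1 (bnd1 B); apply: bnd_mono.
  by rewrite mulr1 /= yreal -rmorphB /= nrm_real; exact/ltW/hN.
by apply/bnd_incl/ltW; rewrite -ltcR -nrmE; exact: hM.
Qed.

Lemma ulim_closed (E : set B) y u :
  closed E -> (forall n, E (y n).2) -> ulim y u -> E u.2.
Proof.
move=> Ec Ey yu; apply: (@closed_cvg _ _ \oo _ (fun n => (y n).2) E Ec).
  by near=> n; exact: Ey.
apply/cvgrPdist_lt => e e0.
have er : e = (complex.Re e)%:C by rewrite RRe_real// gtr0_real.
have e30 : 0 < complex.Re e / 3 by rewrite divr_gt0// -ltcR -er.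
have [N hN] := yu _ e30; exists N => // n /= /hN/bnd_snd h.
by rewrite nrmE er ltcR; apply: le_lt_trans h _; lra.
Unshelve. all: by end_near. Qed.

Lemma ulim_comm y u v : (forall n, v * y n = y n * v) -> ulim y u -> v * u = u * v.
Proof.
move=> vy yu; apply: (@ulim_unique (fun n => v * y n)).
  exact: ulimM (ulim_cst v) yu.
by rewrite (eq_fun vy); exact: ulimM yu (ulim_cst v).
Qed.

End Limits.

(** * The positive cone *)

Section RealScalars.
Context (R : realType) (B : cstarAlgType R).
Local Notation U := (unitization B).
Local Notation rs := (@real_scalar R B).
Implicit Types (u v : U) (c d : R).

Lemma rsD c d : rs (c + d) = rs c + rs d.
Proof. by rewrite /real_scalar rmorphD /= scalerDl. Qed.

Lemma rsN c : rs (- c) = - rs c.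
Proof. by rewrite /real_scalar rmorphN /= scaleNr. Qed.

Lemma rsB c d : rs (c - d) = rs c - rs d.
Proof. by rewrite rsD rsN. Qed.

Lemma rsM c d : rs (c * d) = rs c * rs d.
Proof. by rewrite /real_scalar rmorphM /= -scalerAl mul1r scalerA. Qed.

Lemma rs1 : rs 1 = 1.
Proof. by rewrite /real_scalar rmorph1 scale1r. Qed.

Lemma rs0 : rs 0 = 0.
Proof. by rewrite /real_scalar rmorph0 scale0r. Qed.

Lemma rsl c u : rs c * u = c%:C *: u.
Proof. by rewrite /real_scalar -scalerAl mul1r. Qed.

Lemma rsC c u : rs c * u = u * rs c.
Proof. by rewrite rsl /real_scalar -scalerAr mulr1. Qed.

Lemma rsCA c u v : u * (rs c * v) = rs c * (u * v).
Proof. by rewrite mulrA -rsC mulrA. Qed.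

Lemma conj_real c : ((c%:C : R[i])^*)%R = c%:C.
Proof. by rewrite conj_Creal//; apply/complex_realP; exists c. Qed.

Lemma adj_rs c : adj (rs c) = rs c.
Proof. by rewrite /real_scalar adjZ adj1 conj_real. Qed.

Lemma bnd_rs0 c : 0 <= c -> bnd (rs c) c.
Proof. by move=> c0; have := bnd_rs B c; rewrite ger0_norm. Qed.

Lemma bnd_rsM c d u : 0 <= c -> bnd u d -> bnd (rs c * u) (c * d).
Proof. by move=> /bnd_rs0; exact: bndM. Qed.

(** The unitization of [E], seen inside that of [B]. *)
Definition uni (E : set B) : set U := [set u | E u.2].

Section Uni.
Context (E : set B) (hE : cstar_subalgebra E).

Lemma uniD u v : uni E u -> uni E v -> uni E (u + v).
Proof. exact: csubD. Qed.

Lemma uniZ (k : R[i]) u : uni E u -> uni E (k *: u).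
Proof. exact: csubZ. Qed.

Lemma uniN u : uni E u -> uni E (- u).
Proof. by rewrite -scaleN1r; exact: uniZ. Qed.

Lemma uniB u v : uni E u -> uni E v -> uni E (u - v).
Proof. by move=> Eu Ev; apply/uniD => //; exact: uniN. Qed.

Lemma uniM u v : uni E u -> uni E v -> uni E (u * v).
Proof.
move=> Eu Ev; rewrite /uni /=.
by apply: csubD => //; [apply: csubD => //; exact: csubZ|exact: csubM].
Qed.

Lemma uni_adj u : uni E u -> uni E (adj u).
Proof. exact: csub_star. Qed.

Lemma uni0 : uni E 0.
Proof. exact: csub0 hE. Qed.

Lemma uni1 : uni E 1.
Proof. exact: csub0 hE. Qed.

Lemma uni_rs c : uni E (rs c).
Proof. exact/uniZ/uni1. Qed.

Lemma uni_sum (I : Type) (r : seq I) (P : pred I) (F : I -> U) :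
  (forall i, P i -> uni E (F i)) -> uni E (\sum_(i <- r | P i) F i).
Proof. by move=> h; elim/big_ind: _ => //; [exact: uni0|exact: uniD]. Qed.

End Uni.

Lemma ulim_uni (E : set B) (y : nat -> U) u : cstar_subalgebra E ->
  (forall n, uni E (y n)) -> ulim y u -> uni E u.
Proof. by move=> /csub_closed; exact: ulim_closed. Qed.

Lemma ulim_bnd (y : nat -> U) u c : (forall n, bnd (y n) c) -> ulim y u -> bnd u c.
Proof.
move=> yc yu; apply: bnd_lim => e e0; have [N hN] := yu e e0.
by rewrite addrC -(subrK (y N) u); apply: bndD => //; exact: hN.
Qed.

End RealScalars.

Arguments rsD {R B}.
Arguments rsB {R B}.
Arguments rsM {R B}.
Arguments rs1 {R B}.

Section Psd.
Context (R : realType) (B : cstarAlgType R).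
Local Notation U := (unitization B).
Local Notation rs := (@real_scalar R B).
Implicit Types (u v h k l p : U) (c d t : R) (E : set B).

(** A spectrum-free description of positivity: a selfadjoint [h] has nonnegative
    spectrum exactly if [|t - h| <= t] for some real [t].  Convexity is
    immediate from this form. *)
Definition psd h : Prop := adj h = h /\ exists t, bnd (rs t - h) t.

Lemma bnd_shift h s t : bnd (rs t - h) t -> t <= s -> bnd (rs s - h) s.
Proof.
move=> ht ts; have -> : rs s - h = rs (s - t) + (rs t - h) by rewrite rsB; ncring.
rewrite -[X in bnd _ X](subrK t); apply: bndD => //.
by apply: bnd_rs0; rewrite subr_ge0.
Qed.

Lemma psd0 : psd 0.
Proof. by split; [exact: raddf0|exists 0; rewrite rs0 subrr; exact: bnd0]. Qed.

Lemma psdD h k : psd h -> psd k -> psd (h + k).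
Proof.
move=> [hh [s hs]] [kk [t kt]]; split; first by rewrite raddfD /= hh kk.
exists (s + t); have -> : rs (s + t) - (h + k) = (rs s - h) + (rs t - k).
  by rewrite rsD; ncring.
exact: bndD.
Qed.

Lemma psdZ c h : 0 <= c -> psd h -> psd (rs c * h).
Proof.
move=> c0 [hh [s hs]]; split; first by rewrite adjM hh adj_rs rsC.
by exists (c * s); rewrite rsM -mulrBr; exact: bnd_rsM.
Qed.

Lemma psd_sub h c : adj h = h -> bnd h c -> psd (rs c - h).
Proof.
move=> hh hc; split; first by rewrite raddfB /= adj_rs hh.
by exists c; rewrite opprB addrC subrK.
Qed.

(** With [w = 1 - h], the iteration [y := (w + y^2) / 2] from [0] converges to
    [1 - sqrt h].  As [|w| <= 1], its increments are dominated by those of the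
    scalar iteration [s := (1 + s^2) / 2], which increases and stays below [1].
    The limit inherits commutation and membership from the iterates. *)
Lemma psd_sqrt1 h : adj h = h -> bnd (1 - h) 1 ->
  exists k, [/\ adj k = k, k * k = h, bnd (1 - k) 1,
    forall v, v * h = h * v -> v * k = k * v
    & forall E, cstar_subalgebra E -> uni E h -> uni E k].
Proof.
move=> hh h1; set w := 1 - h.
pose y := fix y n : U := if n is n.+1 then rs 2^-1 * (w + y n * y n) else 0.
pose s := fix s n : R := if n is n.+1 then 2^-1 * (1 + s n * s n) else 0.
have wadj : adj w = w by rewrite raddfB /= adj1 hh.
have yadj n : adj (y n) = y n.
  elim: n => [|n ih] /=; first exact: raddf0.
  by rewrite adjM raddfD /= adjM ih wadj adj_rs rsC.
have yb n : bnd (y n) (s n).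
  elim: n => [|n ih] /=; first exact: bnd0.
  by apply: bnd_rsM; [lra|apply: bndD => //; exact: bndM].
have s0 n : 0 <= s n by exact: bnd_ge0 (yb n).
have s1 n : s n <= 1.
  by elim: n => [|n ih] /=; [exact: ler01|have := s0 n; nra].
have yd n : bnd (y n.+1 - y n) (s n.+1 - s n).
  elim: n => [|n ih].
    rewrite /= !mulr0 !addr0 !subr0 mulr1.
    by have := @bnd_rsM _ _ 2^-1 1 w; rewrite mulr1; apply => //; lra.
  have -> : s n.+2 - s n.+1 = 2^-1 * (s n.+1 * (s n.+1 - s n) + (s n.+1 - s n) * s n).
    by rewrite /=; ring.
  have -> : y n.+2 - y n.+1 = rs 2^-1 * (y n.+1 * (y n.+1 - y n) + (y n.+1 - y n) * y n).
    have yS m : y m.+1 = rs 2^-1 * (w + y m * y m) by [].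
    by rewrite yS {3}yS -mulrBr; congr (_ * _); ncring.
  apply: bnd_rsM; first lra.
  by apply: bndD; [exact: bndM (yb n.+1) ih|exact: bndM ih (yb n)].
have [z yz] := ulim_exists yadj yd s1.
have zE : z = rs 2^-1 * (w + z * z).
  apply: ulim_unique (ulim_shift yz) _.
  apply: ulimM (ulim_cst _) (ulimD (ulim_cst _) (ulimM yz yz)).
have zE2 : z + z = w + z * z.
  have -> : z + z = rs 2 * z by rewrite (rsD 1 1) rs1; ncring.
  by rewrite {1}zE mulrA -rsM divff// rs1 mul1r.
exists (1 - z); split.
- rewrite raddfB /= adj1; congr (_ - _); apply: ulim_unique (ulim_adj yz) _.
  by under eq_fun do rewrite yadj.
- have -> : (1 - z) * (1 - z) = 1 - (z + z) + z * z by ncring.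
  by rewrite zE2 /w; ncring.
- rewrite subKr; apply: ulim_bnd yz => n; exact: bnd_mono (yb n).
- move=> v vh; rewrite mulrBr mulrBl mulr1 mul1r; congr (_ - _).
  apply: ulim_comm yz; elim=> [|n ih] /=; first by rewrite mulr0 mul0r.
  rewrite mulrA -rsC -!mulrA; congr (_ * _).
  by rewrite mulrDr mulrDl mulrBr mulrBl mulr1 mul1r vh mulrA ih -mulrA ih mulrA.
- move=> E hE Eh; apply: uniB; [exact: hE|exact: uni1|].
  have Ew : uni E w by apply: uniB => //; exact: uni1.
  apply: (ulim_uni hE _ yz); elim=> [|n ih]; first exact: uni0.
  by apply: (uniM hE); [exact: uni_rs|apply: uniD => //; exact: uniM].
Qed.

Lemma psd_sqrt h : psd h ->
  exists k, [/\ psd k, k * k = h,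
    forall v, v * h = h * v -> v * k = k * v
    & forall E, cstar_subalgebra E -> uni E h -> uni E k].
Proof.
move=> [hh [t0 ht0]]; pose t := t0 + 1.
have t00 := bnd_ge0 ht0.
have tgt0 : 0 < t by rewrite /t; lra.
have ht : bnd (rs t - h) t by apply: bnd_shift ht0 _; rewrite /t; lra.
have tV : rs t^-1 * rs t = 1 by rewrite -rsM mulVf ?rs1// gt_eqF.
have [] := @psd_sqrt1 (rs t^-1 * h).
- by rewrite adjM hh adj_rs rsC.
- rewrite -[1]tV -mulrBr; have := bnd_rsM _ ht => /(_ t^-1).
  by rewrite mulVf ?gt_eqF//; apply; rewrite invr_ge0 ltW.
move=> k [kk kE kb kc kuni]; pose q := Num.sqrt t.
have qq : rs q * rs q = rs t by rewrite -rsM -expr2 sqr_sqrtr// ltW.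
exists (rs q * k); split.
- split; first by rewrite adjM kk adj_rs rsC.
  exists q; rewrite -{1}[rs q]mulr1 -mulrBr -[X in bnd _ X]mulr1.
  by apply: bnd_rsM => //; exact: sqrtr_ge0.
- rewrite mulrA -[rs q * k * rs q]mulrA -rsC mulrA qq -mulrA kE mulrA -rsM.
  by rewrite divff ?gt_eqF// rs1 mul1r.
- move=> v vh; rewrite mulrA -rsC -!mulrA; congr (_ * _); apply: kc.
  by rewrite mulrA -rsC -!mulrA vh.
- move=> E hE Eh; apply: (uniM hE); first exact: uni_rs.
  by apply: kuni => //; apply: uniM => //; exact: uni_rs.
Qed.

(** [k] is the real part of the element [k + i l], whose square modulus is
    [r ^ 2]. *)
Lemma bnd_sum_sq k l r : adj k = k -> adj l = l -> k * l = l * k ->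
  0 <= r -> k * k + l * l = rs (r ^+ 2) -> bnd k r.
Proof.
move=> kk ll kl r0 e; pose v := k + 'i *: l.
have av : adj v = k - 'i *: l by rewrite raddfD /= adjZ kk ll conjCi scaleNr.
have bv : bnd v r.
  apply: bnd_cstar => //.
  have -> : adj v * v = rs (r ^+ 2).
    rewrite av -e mulrDr !mulrBl -!scalerAl -!scalerAr scalerA mulCii.
    by rewrite scaleN1r kl; ncring.
  by apply: bnd_rs0; exact: sqr_ge0.
have -> : k = rs 2^-1 * (v + adj v).
  rewrite av addrACA subrr addr0 -{2 3}[k]mul1r -rs1 -mulrDl -rsD mulrA -rsM.
  by rewrite mulVf// rs1 mul1r.
have := bnd_rsM _ (bndD bv (bnd_adj bv)) => /(_ 2^-1).
have -> : 2^-1 * (r + r) = r by field.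
by apply; lra.
Qed.

(** The element [r^2 - k^2] is visibly in the cone, hence equals [l^2] with [l]
    commuting with [k]; then [|l| <= r] by [bnd_sum_sq]. *)
Lemma bnd_sub_sq k r : adj k = k -> bnd k r -> bnd (rs (r * r) - k * k) (r * r).
Proof.
move=> kk kr; have r0 := bnd_ge0 kr.
have kk2 : adj (k * k) = k * k by rewrite adjM kk.
have [l [[ll _] lE lc _]] := psd_sqrt (psd_sub kk2 (bndM kr kr)).
have kl : k * l = l * k by apply: lc; rewrite mulrBr mulrBl mulrA rsC.
rewrite -lE; apply: bndM; apply: (bnd_sum_sq ll kk) => //; rewrite lE expr2.
all: by rewrite subrK.
Qed.

Lemma psd_sq k : adj k = k -> psd (k * k).
Proof.
move=> kk; have [r kr] := bnd_exists k; split; first by rewrite adjM kk.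
by exists (r * r); exact: bnd_sub_sq.
Qed.

Lemma bnd_sq k c : adj k = k -> 0 <= c -> bnd (k * k) c -> bnd k (Num.sqrt c).
Proof.
by move=> kk c0 kc; apply: bnd_cstar; rewrite ?sqrtr_ge0// kk sqr_sqrtr.
Qed.

(** Any bound on [h] serves as the witness [t] of its positivity: it is this
    uniformity that makes the cone closed. *)
Lemma psd_bnd h c : psd h -> bnd h c -> bnd (rs c - h) c.
Proof.
move=> ph hc; have c0 := bnd_ge0 hc.
have [k [[kk _] kE _ _]] := psd_sqrt ph.
have kc : bnd k (Num.sqrt c) by apply: bnd_sq; rewrite ?kE.
by have := bnd_sub_sq kk kc; rewrite -expr2 sqr_sqrtr// kE.
Qed.

Lemma psd_le_bnd h c : 0 <= c -> psd h -> psd (rs c - h) -> bnd h c.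
Proof.
move=> c0 ph pch.
have [k [[kk _] kE kc _]] := psd_sqrt ph.
have [l [[ll _] lE lc _]] := psd_sqrt pch.
have kl : k * l = l * k.
  by apply: lc; rewrite mulrBr mulrBl -kE mulrA rsC.
rewrite -kE -[c]sqr_sqrtr// expr2.
have kb : bnd k (Num.sqrt c).
  by apply: (bnd_sum_sq kk ll kl); rewrite ?sqrtr_ge0// sqr_sqrtr// kE lE addrC subrK.
exact: bndM.
Qed.

Lemma psd_closed u v : (forall e, 0 < e -> psd (u + rs e * v)) -> psd u.
Proof.
move=> h; have [c uc] := bnd_exists u; have [d vd] := bnd_exists v.
have c0 := bnd_ge0 uc; have d0 := bnd_ge0 vd; split.
  apply/eqP; rewrite -subr_eq0; apply/eqP; apply: bnd_eq0 => e e0.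
  pose e' := e / (d + d + 1); have D0 : 0 < d + d + 1 by lra.
  have e'0 : 0 < e' by rewrite divr_gt0.
  have [+ _] := h _ e'0; rewrite raddfD /= adjM adj_rs -rsC => he.
  have -> : adj u - u = rs e' * (v - adj v).
    by rewrite mulrBr; apply/eqP; rewrite subr_eq addrAC -subr_eq opprK he addrC.
  apply: bnd_mono (bnd_rsM (ltW e'0) (bndB vd (bnd_adj vd))).
  by rewrite /e' mulrAC ler_pdivrMr// ler_wpM2l ?ltW//; lra.
exists (c + d); apply: bnd_lim => e e0.
pose e' := e / (d + 1 + e); have D0 : 0 < d + 1 + e by lra.
have e'0 : 0 < e' by rewrite divr_gt0.
have e'1 : e' <= 1 by rewrite ler_pdivrMr// mul1r; lra.
have e'd : e' * d <= e.
  by rewrite /e' mulrAC ler_pdivrMr// ler_wpM2l ?ltW//; lra.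
have be : bnd (rs e' * v) (e' * d) := bnd_rsM (ltW e'0) vd.
have b1 : bnd (u + rs e' * v) (c + d).
  by apply: bnd_mono (bndD uc be); rewrite lerD2l; nra.
have -> : rs (c + d) - u = (rs (c + d) - (u + rs e' * v)) + rs e' * v by ncring.
apply: bndD (psd_bnd (h _ e'0) b1) _.
exact: bnd_mono be.
Qed.

(** [p + e = (t + e) (1 - w)] with [w = (t - p) / (t + e)] of norm less than [1]:
    a Neumann series. *)
Lemma psd_add_inv p e : psd p -> 0 < e -> exists r,
  [/\ adj r = r, r * (p + rs e) = 1, (p + rs e) * r = 1
    & forall E, cstar_subalgebra E -> uni E p -> uni E r].
Proof.
move=> [pp [t pt]] e0; have t0 := bnd_ge0 pt.
have te0 : 0 < t + e by lra.
pose q := (t + e)^-1 * t.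
have q0 : 0 <= q by rewrite mulr_ge0// invr_ge0 ltW.
have q1 : q < 1 by rewrite /q mulrC ltr_pdivrMr// mul1r; lra.
pose w := rs (t + e)^-1 * (rs t - p).
have wq : bnd w q by apply: bnd_rsM => //; rewrite invr_ge0 ltW.
have wadj : adj w = w by rewrite adjM raddfB /= !adj_rs pp -rsC.
pose y := fix y n : U := if n is n.+1 then 1 + w * y n else 0.
pose s := fix s n : R := if n is n.+1 then 1 + q * s n else 0.
have wy n : w * y n = y n * w.
  elim: n => [|n ih] /=; first by rewrite mulr0 mul0r.
  by rewrite mulrDr mulrDl mul1r mulr1 ih mulrA ih.
have yadj n : adj (y n) = y n.
  elim: n => [|n ih] /=; first exact: raddf0.
  by rewrite raddfD /= adjM adj1 ih wadj wy.
have yd n : bnd (y n.+1 - y n) (s n.+1 - s n).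
  elim: n => [|n ih].
    by rewrite /= !mulr0 !addr0 !subr0; exact: bnd1.
  have -> : s n.+2 - s n.+1 = q * (s n.+1 - s n) by rewrite /=; ring.
  have -> : y n.+2 - y n.+1 = w * (y n.+1 - y n).
    have yS m : y m.+1 = 1 + w * y m by [].
    by rewrite yS {2}yS; ncring.
  exact: bndM.
have s1 n : s n <= (1 - q)^-1.
  have q10 : 0 < 1 - q by rewrite subr_gt0.
  elim: n => [|n ih] /=; first by rewrite invr_ge0 ltW.
  have -> : (1 - q)^-1 = 1 + q * (1 - q)^-1 by field; rewrite gt_eqF.
  by apply: lerD => //; exact: ler_wpM2l.
have [z yz] := ulim_exists yadj yd s1.
have zE : z = 1 + w * z.
  apply: ulim_unique (ulim_shift yz) _.
  exact: ulimD (ulim_cst _) (ulimM (ulim_cst _) yz).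
have wz : w * z = z * w by exact: ulim_comm wy yz.
have zadj : adj z = z.
  apply: ulim_unique (ulim_adj yz) _.
  by under eq_fun do rewrite yadj.
have wE : p + rs e = rs (t + e) * (1 - w).
  rewrite mulrBr mulr1 /w mulrA -rsM divff ?gt_eqF// rs1 mul1r rsD; ncring.
have teV : rs (t + e)^-1 * rs (t + e) = 1 by rewrite -rsM mulVf ?rs1// gt_eqF.
exists (rs (t + e)^-1 * z); split.
- by rewrite adjM zadj adj_rs rsC.
- rewrite wE -mulrA [z * _]mulrA -rsC -mulrA mulrA teV mul1r mulrBr mulr1 -wz.
  by rewrite {1}zE addrK.
- rewrite wE rsC -!mulrA [rs (t + e) * _]mulrA -rsM mulfV ?gt_eqF// rs1 mul1r.
  by rewrite mulrBl mul1r {1}zE addrK.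
- move=> E hE Ep; apply: (uniM hE); first exact: uni_rs.
  have Ew : uni E w.
    by apply: (uniM hE); [exact: uni_rs|apply: (uniB hE) => //; exact: uni_rs].
  apply: (ulim_uni hE _ yz); elim=> [|n ih]; first exact: uni0.
  by apply: (uniD hE); [exact: uni1|exact: uniM].
Qed.

End Psd.

(** * Positivity of [x^* x] *)

Section Kaplansky.
Context (R : realType) (B : cstarAlgType R).
Local Notation U := (unitization B).
Local Notation rs := (@real_scalar R B).
Implicit Types (u v h k l p : U) (c d t : R) (E : set B).

Lemma adj_mul_eq0 v : adj v * v = 0 -> v = 0.
Proof.
move=> v0; apply: bnd_eq0 => e e0; apply: bnd_cstar; first exact: ltW.
by rewrite v0; apply/bnd0/sqr_ge0.
Qed.

(** [k = y y^*] is in the cone because [y y^* + y^* y] is a sum of squares of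
    selfadjoint elements.  With [m = |y|^2] one has [|m - k| <= m], hence
    [|y^* (m - k) y| <= m^2].  For [G = g^2 = - y^* y] the left-hand element is
    [- (m G + G^2)], and [G^2 <= m G]; so [2 G^2 <= m^2], whereas [|G| = m].
    This forces [m = 0].  It replaces the comparison of the spectra of [y^* y]
    and [y y^*]. *)
Lemma star_mul_neg_sq (y : B) (g : U) :
  adj g = g -> adj (incl y) * incl y = - (g * g) -> incl y = 0.
Proof.
move=> gg; set Y := incl y.
have [G GE] : {G | G = g * g} by exists (g * g).
rewrite -GE => YG.
pose m := nrm y ^+ 2; have m0 : 0 <= m by exact: sqr_ge0.
have Yb : bnd Y (nrm y) by apply/bnd_incl.
have Gadj : adj G = G by rewrite GE adjM gg.
have Gb : bnd G m by rewrite -[G]opprK -YG; apply/bndN/bndM => //; exact: bnd_adj.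
have pk : psd (Y * adj Y).
  have pG : psd G by rewrite GE; exact: psd_sq.
  pose p := Y + adj Y; pose q := 'i *: (Y - adj Y).
  have pp : psd (p * p) by apply: psd_sq; rewrite raddfD /= adjK addrC.
  have pq : psd (q * q).
    by apply: psd_sq; rewrite adjZ raddfB /= adjK conjCi scaleNr -scalerN opprB.
  have half : rs 2^-1 + rs 2^-1 = 1 by rewrite -rsD -rs1; congr real_scalar; field.
  have -> : Y * adj Y = rs 2^-1 * (p * p + q * q) + G.
    have -> : q * q = - ((Y - adj Y) * (Y - adj Y)).
      by rewrite -scalerAl -scalerAr scalerA mulCii scaleN1r.
    have -> : p * p - (Y - adj Y) * (Y - adj Y) = (Y * adj Y - G) + (Y * adj Y - G).
      by rewrite -YG /p; ncring.
    by rewrite mulrDr -mulrDl half; ncring.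
  by apply: psdD => //; apply: psdZ; [lra|exact: psdD].
have kb : bnd (rs m - Y * adj Y) m.
  by apply: psd_bnd => //; apply: bndM => //; exact: bnd_adj.
have b1 : bnd (rs m * G + G * G) (m * m).
  have -> : rs m * G + G * G = - (adj Y * (rs m - Y * adj Y) * Y).
    rewrite mulrBr mulrBl -rsC -[X in _ = - (X - _)]mulrA.
    have -> : adj Y * (Y * adj Y) * Y = (adj Y * Y) * (adj Y * Y) by ncring.
    by rewrite YG; ncring.
  have -> : m * m = nrm y * m * nrm y by rewrite /m; ring.
  by apply/bndN/bndM => //; apply: bndM => //; exact: bnd_adj.
have p1 : psd (rs (m * m) - (rs m * G + G * G)).
  by apply: psd_sub b1; rewrite raddfD /= !adjM Gadj adj_rs rsC.
have p2 : psd (rs m * G - G * G).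
  have [l [[ll _] lE lc _]] := psd_sqrt (psd_sub Gadj Gb).
  have gl : g * l = l * g by apply: lc; rewrite mulrBr mulrBl rsC GE mulrA.
  have -> : rs m * G - G * G = (g * l) * (g * l).
    have -> : g * l * (g * l) = g * (l * g) * l by ncring.
    have -> : g * (l * g) * l = G * (l * l) by rewrite -gl GE; ncring.
    by rewrite lE rsC; ncring.
  by apply: psd_sq; rewrite adjM ll gg.
have b2 : bnd (G * G + G * G) (m * m).
  apply: psd_le_bnd; first by rewrite mulr_ge0.
    by apply: psdD; exact: psd_sq.
  have := psdD p1 p2; congr psd; ncring.
have mm0 : 0 <= 2^-1 * (m * m) by apply: mulr_ge0; [lra|exact: mulr_ge0].
have b3 : bnd G (Num.sqrt (2^-1 * (m * m))).
  apply: bnd_sq => //.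
  have -> : G * G = rs 2^-1 * (G * G + G * G).
    have half : rs 2^-1 + rs 2^-1 = 1 by rewrite -rsD -rs1; congr real_scalar; field.
    by rewrite mulrDr -mulrDl half mul1r.
  by apply: bnd_rsM => //; lra.
have m1 : m <= Num.sqrt (2^-1 * (m * m)).
  rewrite {1}/m -nrm_starM; apply/bnd_incl.
  by rewrite inclM -adj_incl YG; exact: bndN.
have m00 : m = 0.
  apply/eqP; rewrite -sqrf_eq0 expr2.
  have : m * m <= 2^-1 * (m * m).
    rewrite -[X in _ <= X]sqr_sqrtr//.
    by rewrite expr2 ler_pM.
  by move=> h; apply/eqP; nra.
rewrite /Y; have -> : y = 0 by apply: nrm0_eq0; apply/eqP; rewrite -sqrf_eq0 -/m m00.
exact: raddf0.
Qed.

(** Let [h = x^* x], [a = |h| = sqrt (h^2)] and [u = a - h], twice the negative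
    part of [h].  From [h u = - a u] the element [y = x u] satisfies
    [y^* y = - u a u = - (l u)^2] with [l = sqrt a], so [y = 0].  Then
    [u a u = 0], which gives [u^3 = 2 u a u = 0] and [h = a]. *)
Lemma psd_star_mul (x : B) : psd (incl (star x * x)%g).
Proof.
set h := incl _; pose X := incl x.
have hX : h = adj X * X by rewrite /h inclM adj_incl.
have hh : adj h = h by rewrite hX adjM adjK.
have [a [pa aE ac _]] := psd_sqrt (psd_sq hh).
have [aa _] := pa.
have ha : h * a = a * h by apply: ac; rewrite mulrA.
pose u := a - h.
have uu : adj u = u by rewrite raddfB /= aa hh.
have [l [[ll _] lE lc _]] := psd_sqrt pa.
have ul : u * l = l * u by apply: lc; rewrite mulrBl mulrBr ha.
have hu : h * u = - (a * u) by rewrite mulrBr -aE ha mulrBr aE; ncring.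
have glu : (l * u) * (l * u) = u * a * u.
  by rewrite -{1}ul -lE; ncring.
have Xu0 : X * u = 0.
  have -> : X * u = incl (X * u).2 by apply: inclP; exact: mul0r.
  apply: (@star_mul_neg_sq _ (l * u)); first by rewrite adjM ll uu ul.
  rewrite -inclP; last exact: mul0r.
  rewrite adjM uu glu; have -> : u * adj X * (X * u) = u * (h * u) by rewrite hX; ncring.
  by rewrite hu; ncring.
have uau : u * a * u = 0.
  have : adj X * (X * u) = 0 by rewrite Xu0 mulr0.
  rewrite mulrA -hX hu => /eqP; rewrite oppr_eq0 => /eqP e.
  by rewrite -mulrA e mulr0.
have uuE : u * u = a * u + a * u.
  by rewrite {1}/u mulrBl hu opprK.
have u3 : u * u * u = 0.
  by rewrite -mulrA uuE mulrDr mulrA uau addr0.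
have u2 : u * u = 0.
  by apply: adj_mul_eq0; rewrite adjM uu mulrA u3 mul0r.
have u1 : u = 0 by apply: adj_mul_eq0; rewrite uu.
by have /eqP : a - h = 0 := u1; rewrite subr_eq0 => /eqP <-.
Qed.

End Kaplansky.

Section CStarPos.
Context (R : realType) (B : cstarAlgType R).

Lemma cstar_pos_psd (E : set B) (x : B) : cstar_pos E x -> psd (incl x).
Proof. by move=> [d _ ->]; exact: psd_star_mul. Qed.

(** The square root of [x] has scalar part zero, since that part squares to
    zero; so it lies in [E] and not merely in its unitization. *)
Lemma psd_cstar_pos (E : set B) (x : B) :
  cstar_subalgebra E -> E x -> psd (incl x) -> cstar_pos E x.
Proof.
move=> hE Ex /psd_sqrt[k [[kk _] kE _ kuni]].
have k1 : k.1 = 0.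
  have /eqP : k.1 * k.1 = 0 by exact: (congr1 fst kE).
  by rewrite mulf_eq0 orbb => /eqP.
have kI : k = incl k.2 := inclP k1.
have k2 : star k.2 = k.2 := congr1 snd kk.
exists k.2; first exact: (kuni E hE).
rewrite k2; have : incl (k.2 * k.2)%g = incl x by rewrite inclM -kI.
by move=> /(congr1 snd) /= ->.
Qed.

End CStarPos.

(** * Completing squares in sesquilinear forms *)

Section PositiveForms.
Context (R : realType) (B : cstarAlgType R).
Local Notation U := (unitization B).
Local Notation rs := (@real_scalar R B).
Context (D : set B) (hD : cstar_subalgebra D).

(** Biadditive forms with values in the unitization of [B], on a ring on which
    it acts by left multiplication through [rho]; the adjoint relation is only
    asked over [D]. *)
Record balanced_form (V : nzRingType) (rho : U -> V) (F : V -> V -> U) : Prop :=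
  BalancedForm {
    rhoD : {morph rho : c d / c + d};
    rhoM : {morph rho : c d / c * d};
    rho1 : rho 1 = 1;
    formDl : forall x x' y, F (x + x') y = F x y + F x' y;
    formDr : forall x y y', F x (y + y') = F x y + F x y';
    form_adj : forall c x y, uni D c -> F (rho c * x) y = F x (rho (adj c) * y);
    form_rs : forall e x y, F x (rho (rs e) * y) = rs e * F x y }.

Definition qform (V : nzRingType) (rho : U -> V) (F : V -> V -> U) (n : nat)
    (P : nat -> nat -> U) (w : nat -> V) : U :=
  \sum_(k < n) \sum_(l < n) F (w k) (rho (P k l) * w l).

(** Hermitian matrices over [D] itself: the vanishing of scalar parts keeps Schur
    complements, and the vectors met when completing squares, inside the ideal
    [D] of its unitization, where positivity of [x^* x] is known. *)
Record hermitian_in (P : nat -> nat -> U) : Prop := HermitianIn {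
  herm_scalar : forall k l, (P k l).1 = 0;
  herm_in : forall k l, uni D (P k l);
  herm_adj : forall k l, adj (P k l) = P l k }.

Definition schur (n : nat) (P : nat -> nat -> U) (r : U) (k l : nat) : U :=
  P k l - P k n * r * P n l.

Lemma schur_hermitian n P r :
  uni D r -> adj r = r -> hermitian_in P -> hermitian_in (schur n P r).
Proof.
move=> Dr rr [P1 P2 P3]; split=> k l.
- have -> : (schur n P r k l).1 = (P k l).1 - (P k n).1 * r.1 * (P n l).1 by [].
  by rewrite !P1 mulr0 subr0.
- by apply: (uniB hD) => //; apply: (uniM hD) => //; apply: (uniM hD).
- by rewrite raddfB /= !adjM !P3 rr mulrA.
Qed.

Section Schur.
Context (V : nzRingType) (rho : U -> V) (F : V -> V -> U).
Context (FB : balanced_form rho F).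

Let F0l y : F 0 y = 0.
Proof. by apply: (@addrI _ (F 0 y)); rewrite -(formDl FB) !addr0. Qed.
Let F0r x : F x 0 = 0.
Proof. by apply: (@addrI _ (F x 0)); rewrite -(formDr FB) !addr0. Qed.
Let rho0 : rho 0 = 0.
Proof. by apply: (@addrI _ (rho 0)); rewrite -(rhoD FB) !addr0. Qed.
Let rhoN c : rho (- c) = - rho c.
Proof. by apply: (@addrI _ (rho c)); rewrite -(rhoD FB) !subrr. Qed.
Let FNr x y : F x (- y) = - F x y.
Proof. by apply: (@addrI _ (F x y)); rewrite -(formDr FB) !subrr. Qed.

Lemma form_suml n (x : nat -> V) y :
  F (\sum_(k < n) x k) y = \sum_(k < n) F (x k) y.
Proof. by apply: (big_morph (F^~ y)) => // u v; exact: formDl FB _ _ _. Qed.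

Lemma form_sumr n x (y : nat -> V) :
  F x (\sum_(k < n) y k) = \sum_(k < n) F x (y k).
Proof. by apply: (big_morph (F x)) => // u v; exact: formDr FB _ _ _. Qed.

(** Completion of the square in the last variable.  Adding [e] to the last
    diagonal entry makes it invertible, with inverse [r]. *)
Lemma qform_schur (n : nat) (P : nat -> nat -> U) (w : nat -> V) (e : R) (r : U)
    (S := \sum_(l < n) rho (P n l) * w l)
    (v := w n + rho r * S) :
  hermitian_in P -> uni D r -> adj r = r -> r * (P n n + rs e) = 1 ->
  (P n n + rs e) * r = 1 ->
  qform rho F n.+1 P w + rs e * F (w n) (w n) =
  F v (rho (P n n) * v) + rs e * F v v + qform rho F n (schur n P r) w.
Proof.
move=> [P1 PD Padj] Dr rr rp pr; set p := P n n + rs e in rp pr.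
have FrS x y : F (rho r * x) y = F x (rho r * y) by rewrite (form_adj FB)// rr.
have FS y : F S y = \sum_(k < n) F (w k) (rho (P k n) * y).
  rewrite /S (form_suml _ (fun l => rho (P n l) * w l)).
  by apply: eq_bigr => k _; rewrite (form_adj FB)// Padj.
have Sr x c : F x (c * S) = \sum_(l < n) F x (c * (rho (P n l) * w l)).
  rewrite /S mulr_sumr.
  exact: (form_sumr _ _ (fun l => c * (rho (P n l) * w l))).
have pv x y : F x (rho (P n n) * y) + rs e * F x y = F x (rho p * y).
  by rewrite -(form_rs FB) -(formDr FB) -mulrDl -(rhoD FB).
have -> : qform rho F n (schur n P r) w = qform rho F n P w - F S (rho r * S).
  rewrite FS /qform -sumrB; apply: eq_bigr => k _.
  rewrite mulrA Sr -sumrB; apply: eq_bigr => l _.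
  by rewrite /schur (rhoD FB) rhoN !(rhoM FB) mulrBl (formDr FB) FNr !mulrA.
have -> : qform rho F n.+1 P w =
    qform rho F n P w + F S (w n) + F (w n) S + F (w n) (rho (P n n) * w n).
  rewrite /qform big_ord_recr /= big_ord_recr /= addrA; congr (_ + _ + _).
    under eq_bigr do rewrite big_ord_recr /=.
    by rewrite big_split /= -FS.
  by rewrite -[S]mul1r Sr; apply: eq_bigr => l _; rewrite mul1r.
rewrite pv -addrA pv /v mulrDr mulrA -(rhoM FB) pr (rho1 FB) mul1r.
rewrite !(formDl FB) !(formDr FB) !FrS !mulrA -!(rhoM FB) rp (rho1 FB) mul1r.
ncring.
Qed.

End Schur.

(** Positivity of a matrix over [D] is positivity of the form attached to
    [adj x * y] on the unitization, so that [qform_schur] also governs the Schur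
    complement of the matrix. *)
Lemma adj_mul_balanced : balanced_form (fun c : U => c) (fun x y : U => adj x * y).
Proof.
split=> //.
- by move=> x x' y; rewrite raddfD mulrDl.
- by move=> x y y'; rewrite mulrDr.
- by move=> c x y _; rewrite adjM mulrA.
- by move=> e x y; exact: rsCA.
Qed.

(** A matrix positive over [D], applied to a form positive on a [D]-module [W],
    gives a positive value.  The square split off by [qform_schur] is
    [F(k v, k v) + e F(v, v)] with [k^2 = P n n].  The Schur complement is again
    positive: at [c] its form is that of [P] at the extension of [c] by
    [- r S], for which the completed square vanishes. *)
Lemma qform_psd (V : nzRingType) (rho : U -> V) (F : V -> V -> U) (W : V -> Prop)
    (FB : balanced_form rho F) :
    (forall x y, W x -> W y -> W (x + y)) ->
    (forall c x, uni D c -> W x -> W (rho c * x)) ->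
    (forall x, W x -> psd (F x x)) ->
  forall n (P : nat -> nat -> U), hermitian_in P ->
    (forall c : nat -> U, (forall k, uni D (c k)) ->
      psd (qform (fun c : U => c) (fun x y : U => adj x * y) n P c)) ->
  forall w, (forall k, W (w k)) -> psd (qform rho F n P w).
Proof.
move=> WD WM Wpsd; elim=> [|n ih] P hP QP w Ww.
  by rewrite /qform big_ord0; exact: psd0.
have pn : psd (P n n).
  pose c k : U := if k == n then 1 else 0.
  have := QP c; rewrite /qform big_ord_recr /= big_ord_recr /=.
  rewrite big1 ?add0r; last first.
    move=> i _; have ci : c i = 0 by rewrite /c ltn_eqF.
    by rewrite big1 // => j _; rewrite ci raddf0 mul0r.
  rewrite big1 ?add0r; last first.
    move=> i _; have -> : c i = 0 by rewrite /c ltn_eqF.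
    by rewrite !mulr0.
  rewrite /c eqxx adj1 mul1r mulr1; apply => k.
  by case: ifP => _; [exact: uni1|exact: uni0].
(* Regularize by [e] to have an inverse, and let [e] tend to [0]. *)
apply: (@psd_closed _ _ _ (F (w n) (w n))) => e e0.
have [r [rr rp pr /(_ D hD (herm_in hP n n)) Dr]] := psd_add_inv pn e0.
have hS := schur_hermitian n Dr rr hP.
rewrite (qform_schur FB w hP Dr rr rp pr).
set v := w n + _.
(* The zero multiple keeps the empty sum in [W]. *)
have WS : forall m, W (rho 0 * w 0%N + \sum_(l < m) rho (P n l) * w l).
  elim=> [|m ihm]; first by rewrite big_ord0 addr0; apply: WM => //; exact: uni0.
  by rewrite big_ord_recr /= addrA; apply: WD => //; apply: WM => //; exact: herm_in hP _ _.
have rho0 : rho 0 = 0 by apply: (@addrI _ (rho 0)); rewrite -(rhoD FB) !addr0.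
have Wv : W v.
  apply: WD => //; apply: WM => //.
  by have := WS n; rewrite rho0 mul0r add0r.
apply: psdD; first apply: psdD.
- have [k [[kk _] kE _ /(_ D hD (herm_in hP n n)) Dk]] := psd_sqrt pn.
  rewrite -kE (rhoM FB) -mulrA -{1}kk -(form_adj FB)//.
  exact/Wpsd/WM.
- by apply: psdZ; [exact: ltW|exact: Wpsd].
apply: ih => // c Dc.
pose S := \sum_(l < n) P n l * c l.
(* The choice of the last coordinate that annihilates the completed square. *)
pose c' k := if (k < n)%N then c k else - (r * S).
have -> : qform (fun c : U => c) (fun x y : U => adj x * y) n (schur n P r) c =
    qform (fun c : U => c) (fun x y : U => adj x * y) n (schur n P r) c'.
  by apply: eq_bigr => k _; apply: eq_bigr => l _; rewrite /c' !ltn_ord.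
have c'n : c' n = - (r * S) by rewrite /c' ltnn.
have := qform_schur adj_mul_balanced c' hP Dr rr rp pr.
have -> : \sum_(l < n) P n l * c' l = S.
  by apply: eq_bigr => l _; rewrite /c' ltn_ord.
have -> : c' n + r * S = 0 by rewrite c'n addNr.
rewrite !mulr0 !add0r => <-.
have DS : uni D S by apply: (uni_sum hD) => l _; apply: (uniM hD) => //; exact: herm_in hP _ _.
have DrS : uni D (- (r * S)) by apply: (uniN hD); exact: (uniM hD).
apply: psdD.
  by apply: QP => k; rewrite /c'; case: ifP.
apply: psdZ; first exact: ltW.
have : (c' n).1 = 0.
  have -> : (c' n).1 = - (r.1 * S.1) by rewrite c'n.
  have -> : S.1 = \sum_(l < n) (P n l).1 * (c l).1.
    exact: (big_morph (fun u : U => u.1) (fun _ _ => erefl) erefl).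
  by rewrite big1 ?mulr0 ?oppr0// => l _; rewrite (herm_scalar hP) mul0r.
by move=> /inclP ->; rewrite adj_incl -inclM; exact: psd_star_mul.
Qed.

End PositiveForms.

(** * Generation of an amalgamated free product *)

Section GeneratedSubalgebra.
Context (K : comPzRingType) (A : nuAlgType K).

Record subalgebra_closed (P : set A) : Prop := SubalgebraClosed {
  sclosed0 : P 0;
  sclosedL : forall (k : K) x y, P x -> P y -> P (k *: x + y);
  sclosedM : forall x y, P x -> P y -> P (x * y)%g }.

Context (P : set A) (hP : subalgebra_closed P).

(** The closure proof is an argument so that instances can be attached to the
    predicate and to the type below. *)
Definition subalg_pred of subalgebra_closed P : {pred A} := fun x => `[< P x >].

Fact subalg_pred_closed : submod_closed (subalg_pred hP).
Proof.
split; first by apply/asboolP; exact: sclosed0.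
by move=> k x y /asboolP Px /asboolP Py; apply/asboolP; exact: sclosedL.
Qed.

HB.instance Definition _ :=
  GRing.isSubmodClosed.Build K A (subalg_pred hP) subalg_pred_closed.

Record subalg := Subalg { subalg_val : A; _ : subalg_val \in subalg_pred hP }.

HB.instance Definition _ := [isSub for subalg_val].
HB.instance Definition _ := [Choice of subalg by <:].
HB.instance Definition _ := [SubChoice_isSubLmodule of subalg by <:].

Fact subalg_mulP (x y : subalg) : (val x * val y)%g \in subalg_pred hP.
Proof.
by apply/asboolP; apply: (sclosedM hP); apply/asboolP; [exact: (valP x)|exact: (valP y)].
Qed.

Definition subalg_mul (x y : subalg) : subalg := Subalg (subalg_mulP x y).

Fact subalg_mulA : associative subalg_mul.
Proof. by move=> x y z; apply: val_inj; rewrite /= mulgA. Qed.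

HB.instance Definition _ := isSemigroup.Build subalg subalg_mulA.

Let valM (x y : subalg) : val (x * y)%g = (val x * val y)%g. Proof. by []. Qed.
Let valD (x y : subalg) : val (x + y) = val x + val y. Proof. exact: raddfD. Qed.
Let valZ k (x : subalg) : val (k *: x) = k *: val x. Proof. exact: linearZ. Qed.

Fact subalg_mulDl (x y z : subalg) : ((x + y) * z)%g = (x * z)%g + (y * z)%g.
Proof. by apply: val_inj; rewrite valD !valM valD amulDl. Qed.
Fact subalg_mulDr (x y z : subalg) : (z * (x + y))%g = (z * x)%g + (z * y)%g.
Proof. by apply: val_inj; rewrite valD !valM valD amulDr. Qed.
Fact subalg_scaleAl (k : K) (x y : subalg) : k *: (x * y)%g = ((k *: x) * y)%g.
Proof. by apply: val_inj; rewrite valM !valZ -ascalerAl. Qed.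
Fact subalg_scaleAr (k : K) (x y : subalg) : k *: (x * y)%g = (x * (k *: y))%g.
Proof. by apply: val_inj; rewrite valM !valZ -ascalerAr. Qed.

HB.instance Definition _ := Lmodule_isAlgebra.Build K subalg
  subalg_mulDl subalg_mulDr subalg_scaleAl subalg_scaleAr.

Section Corestriction.
Context (A' : nuAlgType K) (f : {linear A' -> A}) (fP : forall x, P (f x)).

Fact corestrP x : f x \in subalg_pred hP.
Proof. exact/asboolP. Qed.

Definition corestr (x : A') : subalg := Subalg (corestrP x).

Fact corestr_is_linear : linear corestr.
Proof. by move=> k x y; apply: val_inj; rewrite valD valZ /= linearP. Qed.

HB.instance Definition _ := GRing.isLinear.Build K A' subalg _ corestr corestr_is_linear.

End Corestriction.

End GeneratedSubalgebra.

(** The universal map into a subalgebra that contains the images, followed by the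
    inclusion, extends the same data as the identity does; uniqueness equates the
    two. *)
Lemma amalgamated_generated (K : comPzRingType) (B : nuAlgType K)
    (I : Type) (A_ : I -> nuAlgType K) (iota : forall i, {linear B -> A_ i})
    (A : nuAlgType K) (eta : {linear B -> A}) (kappa : forall i, {linear A_ i -> A})
    (P : set A) :
    amalgamated_free_product iota eta kappa -> subalgebra_closed P ->
    (forall b, P (eta b)) -> (forall i a, P (kappa i a)) ->
  forall a, P a.
Proof.
move=> [etaM kM ke univ] hP Peta Pk a.
pose g : {linear B -> subalg hP} := corestr hP Peta.
pose f i : {linear A_ i -> subalg hP} := corestr hP (Pk i).
have gM : alg_hom g by move=> x y; apply: val_inj; rewrite /= etaM.
have fM i : alg_hom (f i) by move=> x y; apply: val_inj; rewrite /= kM.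
have fg i b : f i (iota i b) = g b by apply: val_inj; rewrite /= ke.
have [h [hM hg hf] _] := univ _ g f gM fM fg.
have [h0 _ uniq] := univ _ eta kappa etaM kM ke.
pose vh : {linear A -> A} := (val \o h : {linear A -> A}).
have vhE : vh =1 h0.
  apply: uniq; split=> [x y|b|i x] /=; first by rewrite hM.
    by rewrite hg.
  by rewrite hf.
have idE : (idfun : {linear A -> A}) =1 h0 by apply: uniq; split.
have -> : a = val (h a) by have := vhE a; rewrite -idE /= => ->.
by apply/asboolP; exact: (valP (h a)).
Qed.

(** * Positive conditional expectations *)

Section ConditionalExpectations.
Context (R : realType) (B : cstarAlgType R) (E : set B) (hE : cstar_subalgebra E).
Context (A : starAlgType R[i]) (iota : {linear B -> A}) (iotaM : star_hom iota).
Context (Ex : {linear A -> B}) (ce : cond_expectation iota E Ex).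
Local Notation UB := (unitization B).
Local Notation UA := (unitization A).
Local Notation I := (umap iota).
Local Notation X := (umap Ex).
Implicit Types (s c : UB) (x y : UA).

Lemma umap_iotaM : {morph I : s c / s * c}.
Proof. by apply: umapM; case: iotaM. Qed.

Lemma umap_iota_adj : {morph I : s / adj s}.
Proof. by apply: umap_adj; case: iotaM. Qed.

Lemma ce_in x : uni E (X x).
Proof. by case: ce => h _ _ _; exact: h. Qed.

Lemma ce_id s : uni E s -> X (I s) = s.
Proof. by case: s => l b Es; rewrite /umap /=; case: ce => _ _ _ ->. Qed.

Lemma ce_l s x : uni E s -> X (I s * x) = s * X x.
Proof.
case: ce => _ h1 _ h2 Es; congr pair; rewrite /= !linearD !linearZ /=.
by rewrite h1// h2.
Qed.

Lemma ce_r s x : uni E s -> X (x * I s) = X x * s.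
Proof.
case: ce => _ _ h1 h2 Es; congr pair; rewrite /= !linearD !linearZ /=.
by rewrite h1// h2.
Qed.

Definition cov x y : UB := X (adj x * y) - adj (X x) * X y.

Lemma covDl x x' y : cov (x + x') y = cov x y + cov x' y.
Proof. by rewrite /cov !raddfD /= !mulrDl raddfD /=; ncring. Qed.

Lemma covDr x y y' : cov x (y + y') = cov x y + cov x y'.
Proof. by rewrite /cov !mulrDr raddfD /= [X (y + y')]raddfD /=; ncring. Qed.

Lemma cov_mul s c x y : uni E s -> uni E c ->
  cov (x * I s) (y * I c) = adj s * (cov x y * c).
Proof.
move=> Es Ec; rewrite /cov adjM -umap_iota_adj -mulrA ce_l; last exact: uni_adj.
by rewrite mulrA !ce_r// adjM; ncring.
Qed.

Lemma cov_balanced : balanced_form E I cov.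
Proof.
split.
- exact: raddfD.
- exact: umap_iotaM.
- exact: umap1.
- exact: covDl.
- exact: covDr.
- move=> c x y Ec; rewrite /cov adjM -umap_iota_adj ce_l// adjM mulrA ce_l; last exact: uni_adj.
  by rewrite mulrA.
- move=> e x y; have Ee : uni E (real_scalar B e) := uni_rs hE e.
  have Ie : I (real_scalar B e) = (e%:C)%:A by rewrite /real_scalar linearZ /= umap1.
  have mE z : I (real_scalar B e) * z = e%:C *: z by rewrite Ie -scalerAl mul1r.
  by rewrite /cov !mE -scalerAr !linearZ /= -scalerAr rsl scalerBr.
Qed.

Lemma cov_sum (n : nat) (a : nat -> UA) (c : nat -> UB) : (forall k, uni E (c k)) ->
  cov (\sum_(k < n) a k * I (c k)) (\sum_(k < n) a k * I (c k)) =
  \sum_(k < n) \sum_(l < n) adj (c k) * (cov (a k) (a l) * c l).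
Proof.
move=> Ec; rewrite (form_suml cov_balanced _ (fun k => a k * I (c k))).
apply: eq_bigr => k _; rewrite (form_sumr cov_balanced _ _ (fun l => a l * I (c l))).
by apply: eq_bigr => l _; rewrite cov_mul.
Qed.

Context (Ex_pos : positive_map E Ex).

(** Polarization gives [Ex(u^* v)^* = Ex(v^* u)].  For [v] in [E] this becomes
    [Ex(a)^* b = Ex(a^* ) b] for all [b] in [E]; as there may be no unit, one
    takes for [b] the adjoint of the difference. *)
Lemma ce_star (a : A) : Ex (star a) = star (Ex a).
Proof.
have sa z : star (Ex (star z * z)%g) = Ex (star z * z)%g.
  by have [d _ ->] := Ex_pos z; rewrite starM starK.
pose T (u v : UA) := X (adj u * v).
have TE z : adj (T (incl z) (incl z)) = T (incl z) (incl z).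
  by rewrite /T adj_incl -inclM umap_incl adj_incl sa.
have TDl u u' v : T (u + u') v = T u v + T u' v.
  by rewrite /T raddfD mulrDl raddfD.
have TDr u v v' : T u (v + v') = T u v + T u v'.
  by rewrite /T mulrDr raddfD.
have TZl k u v : T (k *: u) v = k^*%R *: T u v.
  by rewrite /T adjZ -scalerAl linearZ.
have TZr k u v : T u (k *: v) = k *: T u v.
  by rewrite /T -scalerAr linearZ.
have inclZ (k : R[i]) (w : A) : incl (k *: w) = k *: incl w by exact: linearZ.
have pol u v : adj (T (incl u) (incl v)) = T (incl v) (incl u).
  set p := T _ _; set q := T _ _.
  have cancel_ends (e f x y x' y' : UB) : (e + x) + (y + f) = (e + x') + (y' + f) ->
      x + y = x' + y'.
    move=> h; have -> : x + y = (e + x) + (y + f) - e - f by ncring.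
    by rewrite h; ncring.
  have h1 : adj p + adj q = p + q.
    have := TE (u + v); rewrite (raddfD (@incl _ A)) /= !TDl !TDr.
    by rewrite !(raddfD (@adj _ B)) /= !TE => /cancel_ends.
  have h2 : adj q - adj p = p - q.
    have := TE (u + 'i *: v); rewrite (raddfD (@incl _ A)) /= inclZ.
    rewrite !TDl !TDr !TZl !TZr !(raddfD (@adj _ B)) /= TE !adjZ TE.
    rewrite -/p -/q ?conjCK ?rmorphN ?conjCi ?opprK !scalerA !mulrN !mulNr => /cancel_ends.
    rewrite !scaleNr => h; have i0 : ('i : R[i])%R != 0 by exact: neq0Ci.
    by apply: (scalerI i0); rewrite [LHS]scalerBr [RHS]scalerBr addrC.
  have : adj p + adj p = q + q.
    have -> : adj p + adj p = (adj p + adj q) - (adj q - adj p) by ncring.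
    by rewrite h1 h2; ncring.
  have n2 : (2%:R : R[i]) != 0 by rewrite pnatr_eq0.
  move=> h; apply: (scalerI n2); rewrite [LHS]scaler_nat [RHS]scaler_nat.
  by rewrite !mulr2n.
have hb b : E b -> (star (Ex a) * star b)%g = (Ex (star a) * star b)%g.
  move=> Eb; have [_ il ir _] := ce; have [_ ist] := iotaM.
  have := pol (iota (star b)) a.
  rewrite /T !adj_incl -!inclM !umap_incl adj_incl -ist starK il// starM.
  by rewrite ir; [case|exact: csub_star].
have Ea : E (star (Ex a) - Ex (star a)).
  have [h _ _ _] := ce; rewrite -scaleN1r; apply: csubD => //.
    exact: csub_star.
  exact: csubZ.
set d := star (Ex a) - Ex (star a) in Ea.
have d0 : (star (star d) * star d)%g = 0.
  by rewrite starK {1}/d amulDl hb// -amulDl addrN a0mul.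
have sd0 : star d = 0.
  by apply: nrm0_eq0; apply/eqP; rewrite -sqrf_eq0 -nrm_starM d0 nrm0.
have : d = 0 by rewrite -[d]starK sd0 star0.
by move=> /eqP; rewrite subr_eq0 => /eqP.
Qed.

Lemma ce_adj x : X (adj x) = adj (X x).
Proof. by apply: umap_adj; exact: ce_star. Qed.

(** The Schwarz inequality: [cov x x] is [Ex(y^* y)] for [y = x - Ex x], whose
    scalar part is zero. *)
Lemma cov_psd x : psd (cov x x).
Proof.
pose y := x - I (X x).
have Xx := ce_in x.
have y0 : y.1 = 0 by rewrite /y /= subrr.
have -> : cov x x = X (adj y * y).
  rewrite /y raddfB /= -umap_iota_adj mulrBr !mulrBl !raddfB /= !ce_r//.
  rewrite !ce_l ?ce_id//; try exact: uni_adj.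
  by rewrite ce_adj /cov; ncring.
rewrite (inclP y0) adj_incl -inclM umap_incl; exact: cstar_pos_psd (Ex_pos _).
Qed.

End ConditionalExpectations.

(** * Alternating words in the c-free product *)

Lemma mulword_ext (G : magmaType) (x y : nat -> G) n :
  (forall k, (k <= n)%N -> x k = y k) -> mulword x n = mulword y n.
Proof.
elim: n => [|n ih] h /=; first exact: h.
by rewrite h// ih// => k kn; apply: h; exact: leqW.
Qed.

Lemma rev_ord2 (i j : 'I_2) : i <> j -> i = rev_ord j.
Proof.
by case: i => -[|[|//]] ? ; case: j => -[|[|//]] ? h; apply: val_inj => //=;
   exfalso; apply: h; exact: val_inj.
Qed.

Lemma rev_ord2_neq (j : 'I_2) : rev_ord j <> j.
Proof. by case: j => -[|[|//]] ? /(congr1 val). Qed.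

Section CFree.
Context (R : realType) (B : cstarAlgType R) (D E : set B).
Context (hD : cstar_subalgebra D) (hE : cstar_subalgebra E) (DE : D `<=` E).
Context (A_ : 'I_2 -> starAlgType R[i]) (iota : forall j, {linear B -> A_ j}).
Context (iota_hom : forall j, star_hom (iota j)).
Context (Phi_ Psi_ : forall j, {linear A_ j -> B}).
Context (Phi_cond : forall j, cond_expectation (iota j) E (Phi_ j)).
Context (Psi_cond : forall j, cond_expectation (iota j) D (Psi_ j)).
Context (Phi_pos : forall j, positive_map E (Phi_ j)).
Context (Psi_pos : forall j, positive_map D (Psi_ j)).
Context (A : starAlgType R[i]) (eta : {linear B -> A}).
Context (kappa : forall j, {linear A_ j -> A}) (Phi : {linear A -> B}).
Context (free : amalgamated_free_product iota eta kappa).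
Context (eta_hom : star_hom eta) (kappa_hom : forall j, star_hom (kappa j)).
Context (Phi_ce : cond_expectation eta E Phi).
Context (Phi_ext : forall j a, Phi (kappa j a) = Phi_ j a).
Context (Phi_word : forall n (eps : nat -> 'I_2) (a : forall k, A_ (eps k)),
  (forall k, (k < n)%N -> eps k <> eps k.+1) ->
  (forall k, (k <= n)%N -> Psi_ (eps k) (a k) = 0) ->
  let w k := kappa (eps k) (a k) in
  Phi (mulword w n) = mulword (fun k => Phi (w k)) n).

Local Notation UB := (unitization B).
Local Notation UA := (unitization A).
Local Notation UA_ j := (unitization (A_ j)).
Local Notation I := (umap eta).
Local Notation F := (umap Phi).
Local Notation k_ j := (umap (kappa j)).
Local Notation i_ j := (umap (iota j)).
Local Notation f_ j := (umap (Phi_ j)).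
Local Notation p_ j := (umap (Psi_ j)).
Local Notation C := (cov Phi).

Let uDE s : uni D s -> uni E s. Proof. exact: DE. Qed.

Let IM : {morph I : s c / s * c}. Proof. exact: umap_iotaM eta_hom. Qed.
Let Iadj : {morph I : s / adj s}. Proof. exact: umap_iota_adj eta_hom. Qed.
Let kM j : {morph k_ j : s c / s * c}. Proof. by apply: umapM; case: (kappa_hom j). Qed.
Let kadj j : {morph k_ j : s / adj s}. Proof. by apply: umap_adj; case: (kappa_hom j). Qed.
Let ki j s : k_ j (i_ j s) = I s.
Proof. by rewrite /umap /=; case: free => _ _ -> _. Qed.
Let Fl s x : uni D s -> F (I s * x) = s * F x.
Proof. by move=> /uDE; exact: ce_l. Qed.
Let Fr s x : uni D s -> F (x * I s) = F x * s.
Proof. by move=> /uDE; exact: ce_r. Qed.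
Let FI s : uni D s -> F (I s) = s.
Proof. by move=> /uDE; exact: ce_id. Qed.
Let f_adj j a : f_ j (adj a) = adj (f_ j a).
Proof. exact: (ce_adj hE (iota_hom j) (Phi_cond j) (@Phi_pos j)). Qed.
Let p_adj j a : p_ j (adj a) = adj (p_ j a).
Proof. exact: (ce_adj hD (iota_hom j) (Psi_cond j) (@Psi_pos j)). Qed.
Let p_scalar j a : p_ j a = 0 -> a.1 = 0. Proof. by move=> /(congr1 fst). Qed.

(** [span_words n j] is spanned by the unitization of [D] and by the alternating
    products of at most [n] centered letters whose first letter lies in [A_ j].
    Words are built from the left, which is where they multiply the adjoint of
    another word.  A centered element of [UA_ j] has scalar part zero. *)
Inductive span_words : nat -> 'I_2 -> UA -> Prop :=
| SpanBase n j s : uni D s -> span_words n j (I s)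
| SpanAdd n j x y : span_words n j x -> span_words n j y -> span_words n j (x + y)
| SpanWord n j i a w : p_ j a = 0 -> i <> j -> span_words n i w ->
    span_words n.+1 j (k_ j a * w).

Lemma span_mul n j s x : uni D s -> span_words n j x -> span_words n j (I s * x).
Proof.
move=> Ds; elim=> {n j x} [n j c Dc|n j x y _ hx _ hy|n j i a w pa ij hw _].
- by rewrite -IM; apply: SpanBase; exact: uniM.
- by rewrite mulrDr; exact: SpanAdd.
- rewrite -(ki j) mulrA -kM; apply: SpanWord hw => //.
  by rewrite (ce_l (Psi_cond j))// pa mulr0.
Qed.

Lemma span_leq n m j x : (n <= m)%N -> span_words n j x -> span_words m j x.
Proof.
move=> + hx; elim: hx m => {n j x} [n j c Dc|n j x y _ hx _ hy|n j i a w pa ij _ hw] m nm.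
- exact: SpanBase.
- by apply: SpanAdd; [exact: hx|exact: hy].
- by case: m nm => // m nm; apply: SpanWord pa ij _; exact: hw.
Qed.

(** Packing each letter with its index lets a word be extended by one letter
    without dependent types. *)
Definition letter (f : nat -> {j & A_ j}) k : A := kappa (tag (f k)) (tagged (f k)).

Definition reduced (f : nat -> {j & A_ j}) n :=
  (forall k, (k < n)%N -> tag (f k) <> tag (f k.+1)) /\
  (forall k, (k <= n)%N -> Psi_ (tag (f k)) (tagged (f k)) = 0).

Lemma Phi_reduced f n : reduced f n ->
  Phi (mulword (letter f) n) = mulword (fun k => Phi (letter f k)) n.
Proof. by move=> [h1 h2]; exact: (Phi_word (a := fun k => tagged (f k))). Qed.

(** The defining relations multiply on the right; letters of [v] are therefore
    moved one at a time to the end of the word [f]. *)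
Lemma Phi_reduced_span m i v : span_words m i v ->
  forall n f, reduced f n -> tag (f n) <> i ->
  F (incl (mulword (letter f) n) * v) =
  incl (mulword (fun k => Phi (letter f k)) n) * F v.
Proof.
elim=> {m i v} [m i s Ds|m i x y _ hx _ hy|m i j a w pa ji _ hw] n f hf fi.
- by rewrite Fr// FI// umap_incl Phi_reduced.
- by rewrite mulrDr raddfD /= hx// hy// (raddfD F) /= mulrDr.
have aE := inclP (p_scalar pa); set a0 := a.2 in aE.
have a00 : Psi_ i a0 = 0 by have := congr1 snd pa.
(* The word [f] followed by the letter [a0]. *)
pose g k : {j & A_ j} := if (k <= n)%N then f k else Tagged A_ a0.
have gE k : (k <= n)%N -> g k = f k by rewrite /g => ->.
have gn : g n.+1 = Tagged A_ a0 by rewrite /g ltnn.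
have hg : reduced g n.+1.
  case: hf => h1 h2; split=> k; rewrite leq_eqVlt => /orP[/eqP|].
  - by move=> [->]; rewrite gn gE.
  - by rewrite ltnS => kn; rewrite !gE//; [exact: h1|exact: ltnW].
  - by move=> ->; rewrite gn.
  - by rewrite ltnS => kn; rewrite gE//; exact: h2.
have gi : tag (g n.+1) <> j by rewrite gn => /esym.
have := hw _ _ hg gi.
rewrite /= {2 4}/letter gn /= (@mulword_ext _ (letter g) (letter f)); last first.
  by move=> k kn; rewrite /letter gE.
rewrite (@mulword_ext _ (fun k => Phi (letter g k)) (fun k => Phi (letter f k))); last first.
  by move=> k kn; rewrite /letter gE.
rewrite !inclM -mulrA aE umap_incl => ->; rewrite -mulrA; congr (_ * _).
pose h (k : nat) : {j & A_ j} := Tagged A_ a0.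
have hh : reduced h 0 by split.
by have := hw 0%N h hh; rewrite /= /letter /= => -> // /esym.
Qed.

Lemma F_centered j a m i v : p_ j a = 0 -> span_words m i v -> i <> j ->
  F (k_ j a * v) = f_ j a * F v.
Proof.
move=> pa hv ij; have aE := inclP (p_scalar pa).
have a00 : Psi_ j a.2 = 0 by have := congr1 snd pa.
have hh : reduced (fun=> Tagged A_ a.2) 0 by split.
have := Phi_reduced_span hv hh; rewrite /= /letter /= => h.
by rewrite {1}aE umap_incl h; [rewrite Phi_ext {2}aE|exact/nesym].
Qed.

(** In [w^* c v] each letter of [w^* ] can in turn play the part of the central
    letter [c], with the remaining product joined to [v]. *)
Lemma F_middle n i w : span_words n i w -> forall j c m i' v,
  i <> j -> p_ j c = 0 -> span_words m i' v -> i' <> j ->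
  F (adj w * (k_ j c * v)) = adj (F w) * (f_ j c * F v).
Proof.
elim=> {n i w} [n i s Ds|n i x y _ hx _ hy|n i l a w pa li hw ih] j c m i' v ij pc hv i'j.
- by rewrite -Iadj Fl ?FI//; [rewrite (F_centered pc hv)|exact: uni_adj].
- rewrite raddfD mulrDl raddfD /= (hx _ _ _ _ _ ij pc hv i'j).
  by rewrite (hy _ _ _ _ _ ij pc hv i'j) (raddfD F) /= raddfD /= mulrDl.
rewrite adjM -kadj -mulrA.
have hcv : span_words m.+1 j (k_ j c * v) by apply: SpanWord hv.
have pa' : p_ i (adj a) = 0 by rewrite p_adj pa raddf0.
rewrite (ih _ _ _ _ _ li pa' hcv); last exact/nesym.
by rewrite (F_centered pc hv)// (F_centered pa hw)// f_adj adjM [LHS]mulrA.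
Qed.

Lemma F_orthogonal n m i j x y : i <> j -> span_words n i x -> span_words m j y ->
  F (adj x * y) = adj (F x) * F y.
Proof.
move=> + hx; elim: hx => {n i x} [n i s Ds|n i x x' _ hx _ hx'|n i l a w pa li hw _] ij hy.
- by rewrite -Iadj Fl ?FI//; exact: uni_adj.
- rewrite raddfD mulrDl raddfD /= hx// hx'//.
  by rewrite (raddfD F) /= raddfD /= mulrDl.
rewrite adjM -kadj -mulrA.
have pa' : p_ i (adj a) = 0 by rewrite p_adj pa raddf0.
rewrite (F_middle hw li pa' hy); last exact/nesym.
by rewrite (F_centered pa hw)// f_adj adjM [LHS]mulrA.
Qed.

(** Orthogonality to the empty word. *)
Lemma F_adj n i x : span_words n i x -> F (adj x) = adj (F x).
Proof.
move=> hx; have h1 : span_words 0 (rev_ord i) (I 1) by apply: SpanBase; exact: uni1.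
have := F_orthogonal (nesym (@rev_ord2_neq i)) hx h1.
by rewrite umap1 mulr1 umap1 mulr1.
Qed.

Lemma cov_base_l s x : uni D s -> C (I s) x = 0.
Proof. by move=> Ds; rewrite /cov -Iadj Fl ?FI ?subrr//; exact: uni_adj. Qed.

Lemma cov_base_r n i s x : span_words n i x -> uni D s -> C x (I s) = 0.
Proof. by move=> hx Ds; rewrite /cov Fr// FI// (F_adj hx) subrr. Qed.

Lemma cov_orthogonal n m i j x y : i <> j -> span_words n i x -> span_words m j y ->
  C x y = 0.
Proof. by move=> ij hx hy; rewrite /cov (F_orthogonal ij hx hy) subrr. Qed.

(** [a^* b] is [s = Psi(a^* b)], which is absorbed into [v], plus a centered
    letter, to which [F_middle] applies. *)
Lemma cov_letters n m j i i' a b w v :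
  p_ j a = 0 -> p_ j b = 0 -> i <> j -> i' <> j ->
  span_words n i w -> span_words m i' v ->
  C (k_ j a * w) (k_ j b * v) =
  C w (I (p_ j (adj a * b)) * v) + adj (F w) * (cov (Phi_ j) a b * F v).
Proof.
move=> pa pb ij i'j hw hv; rewrite /cov.
set s := p_ j _; have Ds : uni D s by exact: ce_in (Psi_cond j) _.
pose c := adj a * b - i_ j s.
have pc : p_ j c = 0.
  by rewrite raddfB /= (ce_id (Psi_cond j))// subrr.
have -> : adj (k_ j a * w) * (k_ j b * v) =
    adj w * (I s * v) + adj w * (k_ j c * v).
  rewrite -mulrDr -mulrDl -(ki j) -raddfD /= addrC subrK adjM -kadj kM.
  by rewrite !mulrA.
rewrite raddfD /= (F_middle hw ij pc hv i'j) (F_centered pa hw)// (F_centered pb hv)//.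
have -> : f_ j c = f_ j (adj a * b) - s.
  by rewrite raddfB /= (ce_id (Phi_cond j))//; exact: uDE.
rewrite Fl// adjM; ncring.
Qed.

(** Peeling off first letters.  The last clause records that words of length zero
    contribute nothing besides [I s], which starts the induction of
    [cov_span_psd].  With two algebras, all the tails start in the same one. *)
Lemma span_normal n j x : span_words n j x ->
  exists s (N : nat) (a : nat -> UA_ j) (w : nat -> UA),
  [/\ uni D s, x = I s + \sum_(k < N) k_ j (a k) * w k,
      forall k, p_ j (a k) = 0
    & forall k, span_words n.-1 (rev_ord j) (w k)] /\ (n = 0%N -> N = 0%N).
Proof.
elim=> {n j x} [n j s Ds|n j x y _ hx _ hy|n j i a w pa ij hw _].
- exists s, 0%N, (fun=> 0), (fun=> I 0); split=> //; split=> //.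
  + by rewrite big_ord0 addr0.
  + by move=> _; rewrite raddf0.
  + by move=> _; apply: SpanBase; exact: uni0.
- have [s [N [a [w [[Ds xE pa hw] N0]]]]] := hx.
  have [t [M [b [v [[Dt yE pb hv] M0]]]]] := hy.
  exists (s + t), (N + M)%N, (fun k => if (k < N)%N then a k else b (k - N)%N),
    (fun k => if (k < N)%N then w k else v (k - N)%N); split; first split.
  + exact: uniD.
  + rewrite big_split_ord /= (raddfD I) /= xE yE addrACA; congr (_ + (_ + _)).
      by apply: eq_bigr => k _; rewrite ltn_ord.
    by apply: eq_bigr => k _; rewrite ltnNge leq_addr /= addKn.
  + by move=> k; case: ifP.
  + by move=> k; case: ifP.
  + by move=> n0; rewrite N0// M0.
- exists 0, 1%N, (fun=> a), (fun=> w); split=> //; split=> //.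
  + exact: uni0.
  + by rewrite big_ord1 raddf0 add0r.
  + by move=> _; rewrite -(rev_ord2 ij).
Qed.

(** The induction on the length of words: the tails [w k] are shorter. *)
Lemma cov_span_psd n j x : span_words n j x -> psd (C x x).
Proof.
elim: n j x => [|n ih] j x hx.
  have [s [N [a [w [[Ds -> _ _] N0]]]]] := span_normal hx.
  by rewrite N0// big_ord0 addr0 cov_base_l//; exact: psd0.
have [s [N [a [w [[Ds xE pa hw] _]]]]] := span_normal hx.
have nj := @rev_ord2_neq j.
pose Y := \sum_(k < N) k_ j (a k) * w k.
have hY : span_words n.+1 j Y.
  rewrite /Y; elim: (N) => [|M hM].
    by rewrite big_ord0 -(raddf0 I); apply: SpanBase; exact: uni0.
  by rewrite big_ord_recr /=; apply: SpanAdd => //; exact: SpanWord (hw M).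
have CB := cov_balanced hE eta_hom Phi_ce.
have -> : C x x = C Y Y.
  rewrite xE -/Y covDl !covDr (cov_base_l _ Ds) (cov_base_l _ Ds).
  by rewrite (cov_base_r hY Ds) !add0r.
pose P k l := p_ j (adj (a k) * a l).
pose z k := F (w k).
have -> : C Y Y = qform I C N P w +
    cov (Phi_ j) (\sum_(k < N) a k * i_ j (z k)) (\sum_(k < N) a k * i_ j (z k)).
  rewrite (cov_sum hE (iota_hom j) (Phi_cond j)); last by move=> k; exact: ce_in Phi_ce _.
  rewrite /qform -big_split /= {1}/Y (form_suml CB _ (fun k => k_ j (a k) * w k)).
  apply: eq_bigr => k _; rewrite -big_split /= /Y.
  rewrite (form_sumr CB _ _ (fun k => k_ j (a k) * w k)).
  by apply: eq_bigr => l _; exact: (cov_letters (pa k) (pa l) nj nj (hw k) (hw l)).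
apply: psdD; last exact: (cov_psd hE (iota_hom j) (Phi_cond j) (@Phi_pos j)).
have CBD : balanced_form D I C.
  by case: CB => h1 h2 h3 h4 h5 h6 h7; split=> // c u v /uDE; exact: h6.
apply: (qform_psd hD (W := span_words n (rev_ord j)) CBD) => //.
- by move=> u v; exact: SpanAdd.
- by move=> c u; exact: span_mul.
- by move=> u; exact: ih.
- split=> [k l|k l|k l].
  + have -> : (P k l).1 = ((a k).1)^*%R * (a l).1 by [].
    by rewrite (p_scalar (pa l)) mulr0.
  + exact: ce_in (Psi_cond j) _.
  + by rewrite /P -p_adj adjM adjK.
move=> c Dc.
have -> : qform (fun c : UB => c) (fun x y : UB => adj x * y) N P c =
    cov (Psi_ j) (\sum_(k < N) a k * i_ j (c k)) (\sum_(k < N) a k * i_ j (c k)).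
  rewrite (cov_sum hD (iota_hom j) (Psi_cond j))//.
  apply: eq_bigr => k _; apply: eq_bigr => l _; congr (_ * (_ * _)).
  by rewrite /cov (pa l) mulr0 subr0.
exact: (cov_psd hD (iota_hom j) (Psi_cond j) (@Psi_pos j)).
Qed.

(** The span of all reduced words, which turns out to be everything. *)
Definition spanned (x : UA) := exists n (y : 'I_2 -> UA),
  (forall j, span_words n j (y j)) /\ x = \sum_j y j.

Lemma spanned_words n j x : span_words n j x -> spanned x.
Proof.
move=> hx; exists n, (fun i => if i == j then x else I 0); split.
  by move=> i; case: eqP => [->//|_]; apply: SpanBase; exact: uni0.
rewrite (bigD1 j)//= eqxx big1 ?addr0// => i /negbTE ->; exact: raddf0.
Qed.

Lemma spannedD x y : spanned x -> spanned y -> spanned (x + y).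
Proof.
move=> [n [u [hu ->]]] [m [v [hv ->]]].
exists (maxn n m), (fun j => u j + v j); split; last by rewrite big_split.
by move=> j; apply: SpanAdd; [apply: span_leq (hu j)|apply: span_leq (hv j)];
  rewrite ?leq_maxl ?leq_maxr.
Qed.

(** Centering [b] splits the product into a word and a [D]-multiple of [w]. *)
Lemma spanned_letter_neq n i j b w : i <> j -> span_words n i w -> spanned (k_ j b * w).
Proof.
move=> ij hw; set s := p_ j b.
have Ds : uni D s := ce_in (Psi_cond j) b.
have -> : k_ j b * w = I s * w + k_ j (b - i_ j s) * w.
  by rewrite -(ki j) -mulrDl -raddfD /= addrC subrK.
apply: spannedD; first exact: spanned_words (span_mul Ds hw).
apply: spanned_words (SpanWord _ ij hw).
by rewrite raddfB /= (ce_id (Psi_cond j))// subrr.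
Qed.

(** Two adjacent letters of [A_ j] merge, which reduces to
    [spanned_letter_neq]. *)
Lemma spanned_letter_eq n j w : span_words n j w -> forall b, spanned (k_ j b * w).
Proof.
elim=> {n j w} [n j s Ds|n j x y _ hx _ hy|n j i a w pa ij hw _] b.
- exact: spanned_letter_neq (@rev_ord2_neq j) (SpanBase 0 _ Ds).
- by rewrite mulrDr; exact: spannedD.
- by rewrite mulrA -kM; exact: spanned_letter_neq ij hw.
Qed.

Lemma spanned_letter j b x : spanned x -> spanned (k_ j b * x).
Proof.
move=> [n [y [hy ->]]]; rewrite mulr_sumr.
elim/big_ind: _ => [||i _].
- by rewrite -(raddf0 I); apply: (@spanned_words 0 j); apply: SpanBase; exact: uni0.
- exact: spannedD.
have [->|/eqP ij] := eqVneq i j; first exact: spanned_letter_eq (hy j) b.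
exact: spanned_letter_neq ij (hy i).
Qed.

Lemma spannedZ (l : R[i]) x : spanned x -> spanned (l *: x).
Proof.
move=> [n [y [hy ->]]]; exists n, (fun j => l *: y j); split; last exact: scaler_sumr.
move=> j; have -> : l *: y j = I l%:A * y j.
  by rewrite linearZ /= umap1 -scalerAl mul1r.
by apply: span_mul => //; apply: uniZ => //; exact: uni1.
Qed.

(** The left multipliers of [spanned] form a subalgebra containing all letters,
    hence everything; they are applied to [1]. *)
Lemma spanned_incl (a : A) : spanned (incl a).
Proof.
suff h : forall y, spanned y -> spanned (incl a * y).
  rewrite -[incl a]mulr1; apply: h; rewrite -(umap1 eta).
  by apply: (@spanned_words 0 0); apply: SpanBase; exact: uni1.
move: a; apply: (amalgamated_generated (P := fun a => forall y, spanned y -> spanned (incl a * y)) free).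
- split.
  + move=> y _; rewrite raddf0 mul0r -(raddf0 I).
    by apply: (@spanned_words 0 0); apply: SpanBase; exact: uni0.
  + move=> l a b ha hb y hy; rewrite linearP /= mulrDl -scalerAl.
    by apply: spannedD; [apply: spannedZ; exact: ha|exact: hb].
  + by move=> a b ha hb y hy; rewrite inclM -mulrA; apply: ha; exact: hb.
- move=> b y; case: free => _ _ ke _; rewrite -(ke 0 b).
  exact: (@spanned_letter 0 (incl (iota 0 b))).
- by move=> j a y; exact: (@spanned_letter j (incl a)).
Qed.

(** [C] is positive since the components starting in the two algebras are
    orthogonal; adding [Phi(a)^* Phi(a)] gives [Phi(a^* a)]. *)
Lemma cfree_positive : positive_map E Phi.
Proof.
move=> a; apply: psd_cstar_pos => //; first by case: Phi_ce => h _ _ _; exact: h.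
have [n [y [hy aE]]] := spanned_incl a.
have pC : psd (C (incl a) (incl a)).
  rewrite aE !big_ord_recl big_ord0 addr0; set u := y _; set v := y _.
  have uv : ord0 <> lift ord0 ord0 :> 'I_2 by [].
  rewrite covDl !covDr (cov_orthogonal uv (hy _) (hy _)).
  rewrite (cov_orthogonal (nesym uv) (hy _) (hy _)) addr0 add0r.
  by apply: psdD; exact: cov_span_psd (hy _).
have -> : incl (Phi (star a * a)%g) = C (incl a) (incl a) + incl (star (Phi a) * Phi a)%g.
  by rewrite /cov adj_incl -inclM !umap_incl adj_incl -inclM subrK.
by apply: psdD => //; exact: psd_star_mul.
Qed.

End CFree.

Theorem theorem2p3 (R : realType) (B : cstarAlgType R) (D : set B)
  (hD : cstar_subalgebra D)
  (A_ : 'I_2 -> starAlgType R[i])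
  (iota : forall j : 'I_2, {linear B -> A_ j})
  (iota_hom : forall j : 'I_2, star_hom (iota j))
  (iota_inj : forall j : 'I_2, injective (iota j))
  (Phi_ Psi_ : forall j : 'I_2, {linear A_ j -> B})
  (Phi_cond : forall j : 'I_2, cond_expectation (iota j) setT (Phi_ j))
  (Psi_cond : forall j : 'I_2, cond_expectation (iota j) D (Psi_ j))
  (Phi_pos : forall j : 'I_2, positive_map setT (Phi_ j))
  (Psi_pos : forall j : 'I_2, positive_map D (Psi_ j))
  (A : starAlgType R[i]) (eta : {linear B -> A})
  (kappa : forall j : 'I_2, {linear A_ j -> A})
  (Phi Psi : {linear A -> B})
  (hA : cfree_product D iota Phi_ Psi_ eta kappa Phi Psi) :
  positive_map setT Phi /\ positive_map D Psi.
Proof.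
case: hA => free eta_hom kappa_hom Phi_ce Psi_ce Phi_ext Psi_ext rel.
have hT : cstar_subalgebra [set: B] by split=> //; exact: closedT.
split.
  apply: (cfree_positive hD hT _ iota_hom Phi_cond Psi_cond Phi_pos Psi_pos
    free eta_hom kappa_hom Phi_ce Phi_ext) => // n eps a h1 h2.
  exact: (rel n eps a h1 h2).2.
apply: (cfree_positive hD hD _ iota_hom Psi_cond Psi_cond Psi_pos Psi_pos
  free eta_hom kappa_hom Psi_ce Psi_ext) => // n eps a h1 h2.
rewrite /= (rel n eps a h1 h2).1.
(* Both sides are zero: the last factor of the product is. *)
case: n h1 h2 => [|n] h1 h2 /=; first by rewrite Psi_ext h2.
by rewrite Psi_ext h2// amul0.
Qed.
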